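(* Let $G$ be a locally compact abelian group with dual group $\hat G$ and dual Haar measure $\hat\mu$, and let $\lambda\in L^1(\hat G)\cap C_0(\hat G)$ be strictly positive. Let $$\mathcal H=\Big\{\hat{\mathcal F}\hat f\in C_0(G)\ :\ \int_{\hat G}\frac{|\hat f(\gamma)|^2}{\lambda(\gamma)}\,d\hat\mu(\gamma)<\infty\Big\},\qquad \langle f,g\rangle_{\mathcal H}=\int_{\hat G}\frac{\hat f(\gamma)\overline{\hat g(\gamma)}}{\lambda(\gamma)}\,d\hat\mu(\gamma),$$ the reproducing kernel Hilbert space on $G$ with kernel sections $$k_x(y)=\int_{\hat G}\lambda(\gamma)\overline{\gamma(x)}\gamma(y)\,d\hat\mu(\gamma),\qquad x,y\in G.$$ Then $\mathcal H$ is a reproducing kernel Hilbert algebra (RKHA) if and only if $\lambda$ is subconvolutive, i.e. there is a constant $C$ with $(\lambda*\lambda)(\gamma)\le C\lambda(\gamma)$ for all $\gamma\in\hat G$.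
   Context: For a set $X$, $\mathcal L(X)$ is the space of complex-valued functions on $X$. A reproducing kernel Hilbert space (RKHS) on $X$ is a vector subspace $\mathcal H\subset\mathcal L(X)$ with an inner product (linear in the first argument) making it a Hilbert space on which every point evaluation is continuous; $k_x\in\mathcal H$ is the kernel section with $f(x)=\langle f,k_x\rangle$ for all $f\in\mathcal H$. An RKHS $\mathcal H$ is an RKHA if the map $k_x\mapsto k_x\otimes k_x$ ($x\in X$) extends to a bounded linear operator $\Delta\colon\mathcal H\to\mathcal H\otimes\mathcal H$ (Hilbert space tensor product); equivalently, pointwise multiplication extends to a bounded linear operator $\mathcal H\otimes\mathcal H\to\mathcal H$. $\hat{\mathcal F}\colon L^1(\hat G)\to C_0(G)$ is $\hat{\mathcal F}(\hat f)(x)=\int_{\hat G}\hat f(\gamma)\gamma(x)\,d\hat\mu(\gamma)$; elements of $\mathcal H$ are written $f=\hat{\mathcal F}\hat f$ with $\hat f\in L^1(\hat G)$ (integrability of $\hat f$ is automatic from the finiteness of the weighted integral). $C_0$ denotes continuous functions vanishing at infinity, and $(\lambda*\lambda)(\gamma)=\int_{\hat G}\lambda(\alpha)\lambda(\gamma-\alpha)\,d\hat\mu(\alpha)$. *)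

(* Defs.v *)
From HB Require Import structures.
From mathcomp Require Import all_boot all_order all_algebra.
From mathcomp Require Import complex.
From mathcomp Require Import all_classical all_reals all_analysis.

Set Implicit Arguments.
Unset Strict Implicit.
Unset Printing Implicit Defensive.

Import Order.TTheory GRing.Theory Num.Theory.
Import numFieldNormedType.Exports.

Local Open Scope classical_set_scope.
Local Open Scope ring_scope.

(* Borel sigma-algebra of a topological abelian group.  Measurable types are
   pointed in the library; the point is taken to be 0. *)
Definition pointed_at0 (G : PreTopologicalZmodule.type) : Type := G.
HB.instance Definition _ (G : PreTopologicalZmodule.type) :=
  Choice.on (pointed_at0 G).
HB.instance Definition _ (G : PreTopologicalZmodule.type) :=
  isPointed.Build (pointed_at0 G) (0 : G).

Notation borel G :=
  (g_sigma_algebraType (@open G : set (set (pointed_at0 G)))).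

Section ComplexIntegral.
Context {d : measure_display} {T : measurableType d} {R : realType}.
Variable mu : {measure set T -> \bar R}.

Definition cintegrable (f : T -> R[i]) : Prop :=
  mu.-integrable setT (fun x => (complex.Re (f x))%:E) /\
  mu.-integrable setT (fun x => (complex.Im (f x))%:E).

Definition cintegral (f : T -> R[i]) : R[i] :=
  Complex (\int[mu]_x complex.Re (f x)) (\int[mu]_x complex.Im (f x)).

End ComplexIntegral.

Definition vanishing_at_infinity {R : realType} {T : topologicalType}
    (f : T -> R) : Prop :=
  forall e : R, 0 < e ->
    exists K : set T, compact K /\ forall x, ~ K x -> `|f x| < e.

Definition C0 {R : realType} {T : topologicalType} (f : T -> R) : Prop :=
  continuous f /\ vanishing_at_infinity f.

(* The dual group, written additively: continuous unitary characters with
   pointwise multiplication and the compact-open topology.  The regular module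
   R[i]^o carries the usual topology of the complex numbers. *)
Record dual (R : realType) (G : topologicalZmodType) : Type := Dual {
  dual_fun :> G -> R[i];
  dual_norm1 : forall x, `|dual_fun x| = 1;
  dual_add : forall x y, dual_fun (x + y) = dual_fun x * dual_fun y;
  dual_continuous : continuous (dual_fun : G -> R[i]^o) }.

Section DualGroup.
Variables (R : realType) (G : topologicalZmodType).
Local Notation dualG := (dual R G).
Implicit Types a b c : dualG.

Lemma dual_eq a b : (forall x, a x = b x) -> a = b.
Proof.
case: a b => [f f1 f2 f3] [g g1 g2 g3] /= /funext fg.
by move: f1 f2 f3; rewrite fg => f1 f2 f3; congr Dual; exact: Prop_irrelevance.
Qed.

Fact dual_zero_norm (x : G) : `|1 : R[i]| = 1. Proof. exact: normr1. Qed.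
Fact dual_zero_add (x y : G) : 1 = 1 * 1 :> R[i]. Proof. by rewrite mulr1. Qed.
Fact dual_zero_cont : continuous ((fun=> 1) : G -> R[i]^o).
Proof. exact: cst_continuous. Qed.
Definition dual_zero : dualG := Dual dual_zero_norm dual_zero_add dual_zero_cont.

Fact dual_plus_norm a b x : `|a x * b x| = 1.
Proof. by rewrite normrM !dual_norm1 mulr1. Qed.
Fact dual_plus_add a b x y : a (x + y) * b (x + y) = a x * b x * (a y * b y).
Proof. by rewrite !dual_add mulrACA. Qed.
Fact dual_plus_cont a b : continuous ((fun x => a x * b x) : G -> R[i]^o).
Proof.
by move=> x; exact: (@cvgM R[i] G _ _ _ _ _ _ (@dual_continuous _ _ a x)
  (@dual_continuous _ _ b x)).
Qed.
Definition dual_plus a b : dualG :=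
  Dual (dual_plus_norm a b) (@dual_plus_add a b) (@dual_plus_cont a b).

Fact dual_opp_norm a x : `|a (- x)| = 1. Proof. exact: dual_norm1. Qed.
Fact dual_opp_add a x y : a (- (x + y)) = a (- x) * a (- y).
Proof. by rewrite opprD dual_add. Qed.
Fact dual_opp_cont a : continuous ((fun x => a (- x)) : G -> R[i]^o).
Proof.
by move=> x; apply: continuous_comp; [exact: opp_continuous|
  exact: dual_continuous].
Qed.
Definition dual_opp a : dualG :=
  Dual (dual_opp_norm a) (@dual_opp_add a) (@dual_opp_cont a).

HB.instance Definition _ := gen_eqMixin dualG.
HB.instance Definition _ := gen_choiceMixin dualG.

Fact dual_plusA : associative dual_plus.
Proof. by move=> a b c; apply: dual_eq => x /=; rewrite mulrA. Qed.
Fact dual_plusC : commutative dual_plus.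
Proof. by move=> a b; apply: dual_eq => x /=; rewrite mulrC. Qed.
Fact dual_plus0 : left_id dual_zero dual_plus.
Proof. by move=> a; apply: dual_eq => x /=; rewrite mul1r. Qed.
Fact dual_plusN : left_inverse dual_zero dual_opp dual_plus.
Proof.
move=> a; apply: dual_eq => x /=; rewrite -dual_add addNr.
have a0 : a 0 != 0 by rewrite -normr_eq0 dual_norm1 oner_neq0.
by apply: (mulfI a0); rewrite -dual_add addr0 mulr1.
Qed.

HB.instance Definition _ :=
  GRing.isZmodule.Build dualG dual_plusA dual_plusC dual_plus0 dual_plusN.

Definition dual_embedding (a : dualG) : {compact-open, G -> R[i]^o} := a.

HB.instance Definition _ :=
  Topological.copy dualG (initial_topology dual_embedding).

End DualGroup.

Record is_haar {R : realType} {G : PreTopologicalZmodule.type}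
    (mu : {measure set (borel G) -> \bar R}) : Prop := {
  haar_neq0 : mu setT <> 0%E;
  haar_translation : forall (x : G) (A : set (borel G)), measurable A ->
    mu [set (x + y : G) | y in (A : set G)] = mu A;
  haar_compact : forall K : set G, compact K -> (mu K < +oo)%E;
  haar_outer : forall A : set (borel G), measurable A ->
    mu A = ereal_inf [set mu U | U in [set U : set G | open U /\ A `<=` U]];
  haar_inner : forall U : set G, open U ->
    mu U = ereal_sup [set mu K | K in [set K : set G | compact K /\ K `<=` U]] }.

Section Fourier.
Context {R : realType} {G : topologicalZmodType}.

Definition fourier (mu : {measure set (borel G) -> \bar R}) (f : G -> R[i])
    (g : dual R G) : R[i] :=
  cintegral mu (fun x => f x * (g x)^*%C).

Definition inv_fourier (muhat : {measure set (borel (dual R G)) -> \bar R})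
    (h : dual R G -> R[i]) (x : G) : R[i] :=
  cintegral muhat (fun g : dual R G => h g * g x).

(* muhat is normalised so that the Fourier inversion formula holds. *)
Definition is_dual_haar (mu : {measure set (borel G) -> \bar R})
    (muhat : {measure set (borel (dual R G)) -> \bar R}) : Prop :=
  is_haar muhat /\
  forall f : G -> R[i],
    cintegrable mu f -> cintegrable muhat (fourier mu f) ->
    {ae mu, forall x, f x = inv_fourier muhat (fourier mu f) x}.

End Fourier.

(* Hilbert spaces are given as a subset H of an ambient complex vector space V
   together with a form ip : V -> V -> R[i] which is only meaningful on H. *)
Definition hnorm {R : realType} {V : lmodType R[i]} (ip : V -> V -> R[i])
    (u : V) : R :=
  Num.sqrt (complex.Re (ip u u)).

Record is_hilbert {R : realType} {V : lmodType R[i]}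
    (H : set V) (ip : V -> V -> R[i]) : Prop := {
  hilbert_zero : H 0;
  hilbert_linear : forall a u v, H u -> H v -> H (a *: u + v);
  ip_linear : forall a u v w, H u -> H v -> H w ->
    ip (a *: u + v) w = a * ip u w + ip v w;
  ip_conj : forall u v, H u -> H v -> ip v u = ((ip u v)^*)%C;
  ip_ge0 : forall u, H u -> 0 <= ip u u;
  ip_eq0 : forall u, H u -> ip u u = 0 -> u = 0;
  hilbert_complete : forall s : nat -> V, (forall n, H (s n)) ->
    (forall e : R, 0 < e -> exists N : nat, forall m n : nat,
       (N <= m)%N -> (N <= n)%N -> hnorm ip (s m - s n) < e) ->
    exists2 l, H l & (fun n => hnorm ip (s n - l)) @ \oo --> (0 : R) }.

Record is_bounded_linear {R : realType} {V W : lmodType R[i]}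
    (H : set V) (ipH : V -> V -> R[i]) (K : set W) (ipK : W -> W -> R[i])
    (D : V -> W) : Prop := {
  blin_range : forall u, H u -> K (D u);
  blin_linear : forall a u v, H u -> H v -> D (a *: u + v) = a *: D u + D v;
  blin_bounded : exists M : R, forall u, H u ->
    hnorm ipK (D u) <= M * hnorm ipH u }.

(* (T, ipT) with the map tens is a Hilbert space tensor product of H1 and H2;
   this determines it up to a unitary isomorphism compatible with tens. *)
Record is_hilbert_tensor {R : realType} {V1 V2 W : lmodType R[i]}
    (H1 : set V1) (ip1 : V1 -> V1 -> R[i])
    (H2 : set V2) (ip2 : V2 -> V2 -> R[i])
    (T : set W) (ipT : W -> W -> R[i]) (tens : V1 -> V2 -> W) : Prop := {
  tensor_hilbert : is_hilbert T ipT;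
  tensor_range : forall u v, H1 u -> H2 v -> T (tens u v);
  tensor_linearl : forall a u u' v, H1 u -> H1 u' -> H2 v ->
    tens (a *: u + u') v = a *: tens u v + tens u' v;
  tensor_linearr : forall a u v v', H1 u -> H2 v -> H2 v' ->
    tens u (a *: v + v') = a *: tens u v + tens u v';
  tensor_ip : forall u u' v v', H1 u -> H1 u' -> H2 v -> H2 v' ->
    ipT (tens u v) (tens u' v') = ip1 u u' * ip2 v v';
  tensor_dense : forall t (e : R), T t -> 0 < e ->
    exists s : seq (V1 * V2),
      (forall p, p \in s -> H1 p.1 /\ H2 p.2) /\
      hnorm ipT (t - \sum_(p <- s) tens p.1 p.2) < e }.

Section RKHS.
Context {R : realType} {X : Type}.
Variables (H : set (X -> R[i])) (ip : (X -> R[i]) -> (X -> R[i]) -> R[i]).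

Definition is_rkhs : Prop :=
  is_hilbert H ip /\
  forall x f, H f -> forall e : R, 0 < e ->
    exists2 d : R, 0 < d &
      forall g, H g -> hnorm ip (g - f) < d -> complex.Re `|g x - f x| < e.

Definition is_kernel_section (k : X -> X -> R[i]) : Prop :=
  (forall x, H (k x)) /\ (forall x f, H f -> f x = ip f (k x)).

(* The kernel sections of an RKHS are unique, and the Hilbert tensor product is
   unique up to isomorphism, so neither existential is an actual choice. *)
Definition is_rkha : Prop :=
  is_rkhs /\
  exists k, is_kernel_section k /\
  exists (W : lmodType R[i]) (T : set W) (ipT : W -> W -> R[i])
      (tens : (X -> R[i]) -> (X -> R[i]) -> W),
    is_hilbert_tensor H ip H ip T ipT tens /\
    exists Delta : (X -> R[i]) -> W,
      is_bounded_linear H ip T ipT Delta /\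
      forall x, Delta (k x) = tens (k x) (k x).

End RKHS.

Section WeightedSpace.
Context {R : realType} {G : topologicalZmodType}.
Variables (muhat : {measure set (borel (dual R G)) -> \bar R}).
Variable lambda : dual R G -> R.

Definition weighted (h : dual R G -> R[i]) : Prop :=
  cintegrable muhat h /\
  (\int[muhat]_g ((complex.Re `|h g|) ^+ 2 / lambda g)%:E < +oo)%E.

(* By the Riemann-Lebesgue lemma inv_fourier maps integrable functions into
   C_0(G), so membership in C_0(G) is not a further condition. *)
Definition Hspace : set (G -> R[i]) := [set inv_fourier muhat h | h in weighted].

(* A function h with f = inv_fourier muhat h; it is unique up to a null set,
   so that Hip does not depend on the choice. *)
Definition hat (f : G -> R[i]) : dual R G -> R[i] :=
  xget (fun=> 0) [set h | weighted h /\ inv_fourier muhat h = f].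

Definition Hip (f g : G -> R[i]) : R[i] :=
  cintegral muhat
    (fun a : dual R G => hat f a * ((hat g a)^*)%C / ((lambda a)%:C)%C).

Definition Hkernel (x y : G) : R[i] :=
  cintegral muhat
    (fun a : dual R G => ((lambda a)%:C)%C * ((a x)^*)%C * a y).

Definition subconvolutive : Prop :=
  exists C : R, forall g : dual R G,
    (\int[muhat]_a (lambda a * lambda (g - (a : dual R G)))%:E
       <= (C * lambda g)%:E)%E.

End WeightedSpace.

(* Main.v *)
(* The kernel sections span H, and a combination u = sum_x c_x k_x corresponds to
   the trigonometric polynomial p = sum_x c_x conj(x) on the dual group, with
   |u|^2 = int lambda |p|^2.  Since <k_x (x) k_x, k_y (x) k_y> = <k_x, k_y>^2 is
   the transform of lambda * lambda at y - x, also
   |sum_x c_x k_x (x) k_x|^2 = int (lambda * lambda) |p|^2.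
   So the diagonal map is bounded if and only if, for some M,
   int (M^2 lambda - lambda * lambda) |p|^2 >= 0 for all p.  This clearly follows
   from subconvolutivity.  Conversely, trigonometric polynomials separate
   disjoint compact sets and the Haar measure is regular, so |p|^2 can be made to
   approximate any indicator function in L^1 of the continuous integrable density
   M^2 lambda - lambda * lambda, which is therefore nonnegative.

   The same approximation shows that an integrable function is determined almost
   everywhere by its transform, which makes H isometric to a weighted L^2 space.
   The Hilbert tensor square of H is realized as the corresponding space of
   transforms on the square of the dual group.  As lambda is positive and
   vanishes at infinity, the dual group is sigma-compact, whence Fubini's theorem
   is available. *)
From HB Require Import structures.
Require Import Defs.
From mathcomp Require Import all_boot all_order all_algebra.
From mathcomp Require Import complex ring lra.
From mathcomp Require Import all_classical all_reals all_analysis measurable_realfun.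

Set Implicit Arguments.
Unset Strict Implicit.
Unset Printing Implicit Defensive.

Import Order.TTheory GRing.Theory Num.Theory.
Import numFieldNormedType.Exports.

Local Open Scope classical_set_scope.
Local Open Scope ring_scope.

(** The diagonal map is prescribed on kernel sections only, and [is_rkha] admits any realization of
    the tensor square. Hence both enter through Gram matrices alone: [gram_hnorm] turns a Gram
    matrix that is the transform of a density into a norm formula, and it serves for [lambda] and
    for its self-convolution alike. A bound on finite combinations becomes an operator by closing a
    graph. The argument is written for a group [L] with unimodular characters [e x], additive in
    both variables and separating the points of [L]. For the dual group [e x a] is [a x], and
    separation is extensionality of characters. The weighted spaces live over any measure space with
    an injective transform, because they occur twice: on the dual group and on its square. Test
    polynomials are kept within [0, 1], so that their products with a merely integrable function
    stay integrable. *)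

Local Notation modc z := (complex.Re `|z|).

(** * The modulus as a real number (the norm of [R[i]] takes values in [R[i]]) *)

Section ComplexModulus.
Context {R : realType}.
Implicit Types z w : R[i].

Lemma modcE z : modc z = Num.sqrt (complex.Re z ^+ 2 + complex.Im z ^+ 2).
Proof. by rewrite normc_def. Qed.

Lemma modc_ge0 z : 0 <= modc z.
Proof. by rewrite modcE sqrtr_ge0. Qed.

Lemma modc_sqr z : modc z ^+ 2 = complex.Re z ^+ 2 + complex.Im z ^+ 2.
Proof. by rewrite modcE sqr_sqrtr // addr_ge0 // sqr_ge0. Qed.

Lemma modcC z : (modc z)%:C%C = `|z|.
Proof. by rewrite normc_def. Qed.

Lemma modc0 : modc (0 : R[i]) = 0.
Proof. by rewrite normr0. Qed.

Lemma modc_eq0 z : modc z = 0 -> z = 0.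
Proof. by move=> z0; apply/eqP; rewrite -normr_eq0 -modcC z0. Qed.

Lemma modcM z w : modc (z * w) = modc z * modc w.
Proof. by rewrite normrM -(modcC z) -(modcC w) -rmorphM. Qed.

Lemma modcN z : modc (- z) = modc z.
Proof. by rewrite normrN. Qed.

Lemma modcJ z : modc (z^*%C) = modc z.
Proof. by rewrite normcJ. Qed.

Lemma modc_real (x : R) : modc x%:C%C = `|x|.
Proof. by rewrite modcE /= expr0n addr0 sqrtr_sqr. Qed.

Lemma ReD z w : complex.Re (z + w) = complex.Re z + complex.Re w.
Proof. by case: z; case: w. Qed.

Lemma ImD z w : complex.Im (z + w) = complex.Im z + complex.Im w.
Proof. by case: z; case: w. Qed.

Lemma ReB z w : complex.Re (z - w) = complex.Re z - complex.Re w.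
Proof. by case: z; case: w. Qed.

Lemma ImB z w : complex.Im (z - w) = complex.Im z - complex.Im w.
Proof. by case: z; case: w. Qed.

Lemma le_Re_modc z : complex.Re z <= modc z.
Proof.
have := normc_ge_Re z; rewrite -modcC lecR; exact: le_trans (ler_norm _).
Qed.

Lemma modcD z w : modc (z + w) <= modc z + modc w.
Proof.
have := ler_normD z w.
by rewrite -(modcC (z + w)) -(modcC z) -(modcC w) -rmorphD lecR.
Qed.

Lemma mulcJE z : z * z^*%C = (modc z ^+ 2)%:C%C.
Proof. by rewrite -sqr_normc -modcC rmorphXn. Qed.

Lemma conjcD z w : (z + w)^*%C = z^*%C + w^*%C.
Proof. exact: rmorphD. Qed.

Lemma conjcM z w : (z * w)^*%C = z^*%C * w^*%C.
Proof. exact: rmorphM. Qed.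

Lemma conjcN z : (- z)^*%C = - z^*%C.
Proof. exact: rmorphN. Qed.

Lemma le_norm_Re z : `|complex.Re z| <= modc z.
Proof. by have := normc_ge_Re z; rewrite -modcC lecR. Qed.

Lemma le_norm_Im z : `|complex.Im z| <= modc z.
Proof.
by rewrite modcE -[leLHS]sqrtr_sqr ler_wsqrtr // lerDr sqr_ge0.
Qed.

End ComplexModulus.

(** * Hilbert spaces *)

Section Hilbert.
Context {R : realType} {V : lmodType R[i]} {H : set V} {ip : V -> V -> R[i]}.
Hypothesis hH : is_hilbert H ip.
Local Notation nrm := (hnorm ip).
Implicit Types (a : R[i]) (u v w : V).

Lemma hilbertD u v : H u -> H v -> H (u + v).
Proof. by move=> Hu Hv; have := hilbert_linear hH 1 Hu Hv; rewrite scale1r. Qed.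

Lemma hilbertZ a u : H u -> H (a *: u).
Proof.
move=> Hu; have := hilbert_linear hH a Hu (hilbert_zero hH).
by rewrite addr0.
Qed.

Lemma hilbertN u : H u -> H (- u).
Proof. by move=> Hu; rewrite -scaleN1r; exact: hilbertZ. Qed.

Lemma hilbertB u v : H u -> H v -> H (u - v).
Proof. by move=> Hu Hv; apply: hilbertD => //; exact: hilbertN. Qed.

Lemma hilbert_sum (I : Type) (s : seq I) (F : I -> V) :
  (forall i, H (F i)) -> H (\sum_(i <- s) F i).
Proof.
move=> HF; elim/big_ind : _ => //; [apply: hilbert_zero hH|move=> x y; exact: hilbertD].
Qed.

Lemma ipDl u v w : H u -> H v -> H w -> ip (u + v) w = ip u w + ip v w.
Proof.
by move=> Hu Hv Hw; have := ip_linear hH 1 Hu Hv Hw; rewrite scale1r mul1r.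
Qed.

Lemma ip0l w : H w -> ip 0 w = 0.
Proof.
move=> Hw; have H0 := hilbert_zero hH.
have /eqP := ipDl H0 H0 Hw.
by rewrite addr0 -[X in X == _]addr0 (inj_eq (addrI _)) eq_sym => /eqP.
Qed.

Lemma ipZl a u w : H u -> H w -> ip (a *: u) w = a * ip u w.
Proof.
move=> Hu Hw; have H0 := hilbert_zero hH.
by have := ip_linear hH a Hu H0 Hw; rewrite addr0 (ip0l Hw) addr0.
Qed.

Lemma ipDr u v w : H u -> H v -> H w -> ip w (u + v) = ip w u + ip w v.
Proof.
move=> Hu Hv Hw; have Huv := hilbertD Hu Hv.
by rewrite (ip_conj hH Huv Hw) ipDl // conjcD -!(ip_conj hH).
Qed.

Lemma ip0r w : H w -> ip w 0 = 0.
Proof.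
by move=> Hw; rewrite (ip_conj hH (hilbert_zero hH) Hw) (ip0l Hw) conjc0.
Qed.

Lemma ipZr a u w : H u -> H w -> ip w (a *: u) = a^*%C * ip w u.
Proof.
move=> Hu Hw; rewrite (ip_conj hH (hilbertZ a Hu) Hw) ipZl // conjcM.
by rewrite -(ip_conj hH).
Qed.

Lemma ip_suml (I : Type) (s : seq I) (F : I -> V) w :
  (forall i, H (F i)) -> H w ->
  ip (\sum_(i <- s) F i) w = \sum_(i <- s) ip (F i) w.
Proof.
move=> HF Hw; elim: s => [|i s IH]; first by rewrite !big_nil ip0l.
by rewrite !big_cons ipDl ?IH //; exact: hilbert_sum.
Qed.

Lemma ip_sumr (I : Type) (s : seq I) (F : I -> V) w :
  (forall i, H (F i)) -> H w ->
  ip w (\sum_(i <- s) F i) = \sum_(i <- s) ip w (F i).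
Proof.
move=> HF Hw; elim: s => [|i s IH]; first by rewrite !big_nil ip0r.
by rewrite !big_cons ipDr ?IH //; exact: hilbert_sum.
Qed.

Lemma hnorm_ge0 u : 0 <= nrm u.
Proof. exact: sqrtr_ge0. Qed.

Lemma hnorm_sqr u : H u -> nrm u ^+ 2 = complex.Re (ip u u).
Proof.
by move=> /(ip_ge0 hH); rewrite lecE => /andP[_ /= h]; rewrite sqr_sqrtr.
Qed.

Lemma ip_hnorm u : H u -> ip u u = (nrm u ^+ 2)%:C%C.
Proof.
move=> Hu; rewrite hnorm_sqr //; have := ip_ge0 hH Hu; rewrite lecE.
by case: (ip u u) => a b /= /andP[/eqP -> _].
Qed.

Lemma hnorm_eq0 u : H u -> nrm u = 0 -> u = 0.
Proof.
by move=> Hu u0; apply: (ip_eq0 hH) => //; rewrite ip_hnorm // u0 expr0n.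
Qed.

Lemma hnorm0 : nrm 0 = 0.
Proof. by rewrite /hnorm ip0l ?sqrtr0 //; exact: hilbert_zero hH. Qed.

Lemma hnormZ a u : H u -> nrm (a *: u) = modc a * nrm u.
Proof.
move=> Hu; apply/eqP; rewrite -(eqrXn2 (n := 2)) ?mulr_ge0 ?modc_ge0 ?hnorm_ge0 //.
rewrite hnorm_sqr; last exact: hilbertZ.
rewrite ipZl ?ipZr ?ip_hnorm //; try exact: hilbertZ.
by rewrite mulrA mulcJE -rmorphM /= exprMn.
Qed.

Lemma hnormN u : H u -> nrm (- u) = nrm u.
Proof.
move=> Hu; rewrite -scaleN1r hnormZ //.
by rewrite normrN normr1 mul1r.
Qed.

Lemma hnormBC u v : H u -> H v -> nrm (u - v) = nrm (v - u).
Proof. by move=> Hu Hv; rewrite -hnormN ?opprB //; exact: hilbertB. Qed.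

Lemma hnormD_sqr u v : H u -> H v ->
  nrm (u + v) ^+ 2 = nrm u ^+ 2 + 2 * complex.Re (ip u v) + nrm v ^+ 2.
Proof.
move=> Hu Hv; have Huv := hilbertD Hu Hv.
rewrite hnorm_sqr // ipDl // !ipDr // (ip_conj hH Hu Hv) !ip_hnorm //.
by rewrite !ReD /=; case: (ip u v) => a b /=; ring.
Qed.

Lemma hnorm_parallelogram u v : H u -> H v ->
  nrm (u - v) ^+ 2 = 2 * nrm u ^+ 2 + 2 * nrm v ^+ 2 - nrm (u + v) ^+ 2.
Proof.
move=> Hu Hv; rewrite !hnormD_sqr ?hnormN //; last exact: hilbertN.
rewrite -scaleN1r ipZr // conjcN conjc1 mulN1r.
by case: (ip u v) => a b /=; ring.
Qed.

(** Pythagoras for the projection of [u] onto the line of [v]. It yields Cauchy-Schwarz, and in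
    [hilbert_dense] it turns minimality into orthogonality. *)
Lemma hnorm_sub_proj u v : H u -> H v -> nrm v != 0 ->
  nrm (u - (ip u v / (nrm v ^+ 2)%:C%C) *: v) ^+ 2 =
  nrm u ^+ 2 - modc (ip u v) ^+ 2 / nrm v ^+ 2.
Proof.
move=> Hu Hv v0; set c := ip u v / _.
have Hcv := hilbertZ c Hv.
rewrite hnormD_sqr //; last exact: hilbertN.
rewrite hnormN // hnormZ // -scaleNr ipZr //.
have -> : modc c = modc (ip u v) / nrm v ^+ 2.
  have v2 : 0 <= (nrm v ^+ 2)^-1 by rewrite invr_ge0 exprn_ge0 // hnorm_ge0.
  by rewrite /c modcM -fmorphV modc_real (ger0_norm v2).
have -> : (- c)^*%C * ip u v = (- (modc (ip u v) ^+ 2 / nrm v ^+ 2))%:C%C.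
  rewrite conjcN conjcM -fmorphV conjc_real mulNr rmorphN /= mulrAC.
  by rewrite [_^*%C * _]mulrC mulcJE -rmorphM.
by rewrite /=; field.
Qed.

Lemma cauchy_schwarz u v : H u -> H v -> modc (ip u v) <= nrm u * nrm v.
Proof.
move=> Hu Hv; have [v0|v0] := eqVneq (nrm v) 0.
  by rewrite v0 (hnorm_eq0 Hv v0) ip0r // modc0 mulr0.
have vpos : 0 < nrm v ^+ 2 by rewrite exprn_even_gt0.
rewrite -(ler_pXn2r (n := 2)) ?nnegrE ?modc_ge0 ?mulr_ge0 ?hnorm_ge0 //.
rewrite exprMn -ler_pdivrMr // -subr_ge0 -(hnorm_sub_proj Hu Hv v0).
by rewrite exprn_ge0 // hnorm_ge0.
Qed.

Lemma hnorm_triangle u v : H u -> H v -> nrm (u + v) <= nrm u + nrm v.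
Proof.
move=> Hu Hv; rewrite -(ler_pXn2r (n := 2)) ?nnegrE ?addr_ge0 ?hnorm_ge0 //.
rewrite hnormD_sqr // sqrrD lerD2r lerD2l mulr_natl lerMn2r /=.
exact: le_trans (le_Re_modc _) (cauchy_schwarz Hu Hv).
Qed.

Lemma hnorm_triangleB u v w : H u -> H v -> H w ->
  nrm (u - w) <= nrm (u - v) + nrm (v - w).
Proof.
move=> Hu Hv Hw; rewrite -[u - w](subrKA v).
apply: hnorm_triangle; exact: hilbertB.
Qed.

Lemma hnorm_cvg_lt (s : nat -> V) l :
  (fun n => nrm (s n - l)) @ \oo --> (0 : R) ->
  forall e : R, 0 < e -> exists N, forall n, (N <= n)%N -> nrm (s n - l) < e.
Proof.
move=> sl e e0; have /cvgrPdist_lt /(_ _ e0) [N _ hN] := sl.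
exists N => n Nn; have := hN n Nn; rewrite /= sub0r normrN ger0_norm //.
exact: hnorm_ge0.
Qed.

(* If [d n] is a minimizing sequence for the distance of [t] to [D], then
   [t - d n] converges to a vector orthogonal to [D]. *)
Lemma hilbert_dense (D : set V) : D `<=` H -> D 0 ->
  (forall a u v, D u -> D v -> D (a *: u + v)) ->
  (forall t, H t -> (forall d, D d -> ip t d = 0) -> t = 0) ->
  forall t (e : R), H t -> 0 < e -> exists2 d, D d & nrm (t - d) < e.
Proof.
move=> DH D0 DL Dorth t e Ht e0.
have DD u v : D u -> D v -> D (u + v).
  by move=> Du Dv; have := DL 1 u v Du Dv; rewrite scale1r.
have DZ a u : D u -> D (a *: u).
  by move=> Du; have := DL a u 0 Du D0; rewrite addr0.
pose S := [set nrm (t - d) | d in D].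
have infS : has_inf S.
  by split; [exists (nrm (t - 0)), 0|exists 0 => _ [d _ <-]; exact: hnorm_ge0].
have le_inf d : D d -> inf S <= nrm (t - d).
  by move=> Dd; apply: ge_inf; [exact: infS.2|exists d].
have inf0 : 0 <= inf S.
  by apply: lb_le_inf; [exact: infS.1|move=> _ [d _ <-]; exact: hnorm_ge0].
(* The excess is measured on squared distances, the form in which the parallelogram law uses it. *)
have mini n : exists d, D d /\ nrm (t - d) ^+ 2 < inf S ^+ 2 + n.+1%:R^-1.
  set eta := n.+1%:R^-1; have eta0 : 0 < eta :> R by rewrite invr_gt0.
  have r0 : 0 < Num.sqrt (inf S ^+ 2 + eta) - inf S.
    rewrite subr_gt0 -[ltLHS]ger0_norm // -sqrtr_sqr ltr_sqrt ?ltrDl //.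
    by rewrite ltr_wpDl // exprn_ge0.
  have [_ [d Dd <-]] := inf_adherent r0 infS.
  rewrite [X in _ < X](_ : _ = Num.sqrt (inf S ^+ 2 + eta)); last by ring.
  move=> hd; exists d; split => //.
  rewrite -ltr_sqrt; last by rewrite ltr_wpDl // exprn_ge0.
  by rewrite sqrtr_sqr ger0_norm // hnorm_ge0.
have [d hd] := choice mini; pose s n := t - d n.
have Hd n : H (d n) by apply: DH; exact: (hd n).1.
have Hs n : H (s n) by exact: hilbertB.
(* The midpoint of [d m] and [d n] lies in [D], so half of [s m + s n] has norm at least [inf S]. *)
have Cs m n : nrm (s m - s n) ^+ 2 <= 2 * (m.+1%:R^-1 + n.+1%:R^-1).
  rewrite hnorm_parallelogram //.
  have -> : s m + s n = 2%:R *: (t - 2%:R^-1 *: (d m + d n)).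
    rewrite scalerBr scalerA divff ?pnatr_eq0 // scale1r scaler_nat /s.
    by rewrite mulr2n opprD addrACA.
  have Dmn : D (2%:R^-1 *: (d m + d n)) by apply/DZ/DD; apply: (hd _).1.
  rewrite hnormZ; last by apply: hilbertB => //; exact: DH.
  have -> : modc (2%:R : R[i]) = 2 :> R.
    by rewrite -[2%:R](rmorph_nat (real_complex R)) modc_real ger0_norm.
  have := ltW (hd m).2; have := ltW (hd n).2.
  have : inf S ^+ 2 <= nrm (t - 2%:R^-1 *: (d m + d n)) ^+ 2.
    by rewrite ler_pXn2r ?nnegrE ?hnorm_ge0 ?le_inf.
  set A := nrm (t - _ *: _) => hA hn hm.
  have -> : (2 * A) ^+ 2 = 4 * A ^+ 2 by ring.
  move: hn hm; rewrite -/(s n) -/(s m).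
  set p := m.+1%:R^-1; set q := n.+1%:R^-1; lra.
have [l Hl sl] : exists2 l, H l & (fun n => nrm (s n - l)) @ \oo --> (0 : R).
  apply: (hilbert_complete hH) => // r r0.
  have [N hN] : exists N : nat, N.+1%:R^-1 < r ^+ 2 / 4 :> R.
    have := @near_infty_natSinv_lt R (PosNum (divr_gt0 (exprn_gt0 2 r0) (ltr0Sn R 3))).
    by move=> [N _ hN]; exists N; apply: hN => /=.
  exists N => m n Nm Nn; rewrite -(ltr_pXn2r (n := 2)) ?nnegrE ?hnorm_ge0 ?ltW //.
  apply: le_lt_trans (Cs m n) _.
  have le k : (N <= k)%N -> k.+1%:R^-1 <= N.+1%:R^-1 :> R.
    by move=> Nk; rewrite lef_pV2 ?posrE // ler_nat.
  move: hN (le _ Nm) (le _ Nn).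
  set p := m.+1%:R^-1; set q := n.+1%:R^-1; set p0 := N.+1%:R^-1; lra.
have slt := hnorm_cvg_lt sl.
have l_le : nrm l <= inf S.
  apply/ler_addgt0Pr => r r0; have r2 : 0 < r / 2 by rewrite divr_gt0.
  have [N hN] := slt _ r2.
  have [M hM] : exists M : nat, M.+1%:R^-1 < (r / 2) ^+ 2 :> R.
    have := @near_infty_natSinv_lt R (PosNum (exprn_gt0 2 r2)).
    by move=> [M _ hM]; exists M; apply: hM => /=.
  pose n := maxn N M.
  have sn : nrm (s n) <= inf S + r / 2.
    rewrite -(ler_pXn2r (n := 2)) ?nnegrE ?hnorm_ge0 ?addr_ge0 ?(ltW r2) //.
    apply: le_trans (ltW (hd n).2) _.
    have : n.+1%:R^-1 <= M.+1%:R^-1 :> R.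
      by rewrite lef_pV2 ?posrE // ler_nat ltnS leq_maxr.
    have : 0 <= inf S * (r / 2) by rewrite mulr_ge0 // ltW.
    move: hM; set p := n.+1%:R^-1; set q := M.+1%:R^-1.
    rewrite sqrrD; lra.
  have nl : nrm l <= nrm (s n) + nrm (s n - l).
    have := hnorm_triangleB Hl (Hs n) (hilbert_zero hH).
    by rewrite !subr0 addrC (hnormBC Hl (Hs n)).
  have := hN n (leq_maxl _ _); lra.
have ge_l c : D c -> inf S <= nrm (l - c).
  move=> Dc; apply/ler_addgt0Pr => r r0; have [N hN] := slt _ r0.
  have le1 : inf S <= nrm (s N - c).
    by rewrite /s -addrA -opprD; apply/le_inf/DD => //; exact: (hd N).1.
  have := hnorm_triangleB (Hs N) Hl (DH _ Dc); have := hN _ (leqnn N); lra.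
have l0 : l = 0.
  apply: Dorth => // c Dc; have Hc := DH _ Dc.
  have [c0|c0] := eqVneq (nrm c) 0; first by rewrite (hnorm_eq0 Hc c0) ip0r.
  have cpos : 0 < nrm c ^+ 2 by rewrite exprn_even_gt0.
  (* Subtracting from [l] its projection on [c] would bring the norm below [inf S] unless
     [ip l c = 0]. *)
  have := ge_l _ (DZ (ip l c / (nrm c ^+ 2)%:C%C) _ Dc).
  move=> /(le_trans l_le).
  rewrite -(ler_pXn2r (n := 2)) ?nnegrE ?hnorm_ge0 // (hnorm_sub_proj Hl Hc c0).
  rewrite lerBrDl gerDr pmulr_lle0 ?invr_gt0 // => h.
  by apply: modc_eq0; apply/eqP; rewrite -sqrf_eq0 eq_le h sqr_ge0.
have [N hN] := slt _ e0; exists (d N); first exact: (hd N).1.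
by have := hN _ (leqnn N); rewrite l0 subr0.
Qed.

End Hilbert.

(** * Finite combinations and extension of bounded maps *)

Definition lincomb {K : pzRingType} {V : lmodType K} {X : Type} (k : X -> V)
    (s : seq (K * X)) : V :=
  \sum_(p <- s) p.1 *: k p.2.

Section LinearCombinations.
Context {K : pzRingType} {V : lmodType K} {X : Type}.
Variable k : X -> V.

Definition scale_coefs (a : K) (s : seq (K * X)) :=
  [seq (a * p.1, p.2) | p <- s].

Lemma lincomb_cat s s' : lincomb k (s ++ s') = lincomb k s + lincomb k s'.
Proof. exact: big_cat. Qed.

Lemma lincomb_scale a s : lincomb k (scale_coefs a s) = a *: lincomb k s.
Proof.
rewrite /lincomb big_map scaler_sumr.
by apply: eq_bigr => p _; rewrite scalerA.
Qed.

Lemma lincomb1 x : lincomb k [:: (1, x)] = k x.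
Proof. by rewrite /lincomb big_seq1 scale1r. Qed.

End LinearCombinations.

Section Extension.
Context {R : realType} {V W : lmodType R[i]} {X : Type}.
Context {H : set V} {ipH : V -> V -> R[i]} {T : set W} {ipT : W -> W -> R[i]}.
Hypotheses (hH : is_hilbert H ipH) (hT : is_hilbert T ipT).
Variables (k : X -> V) (t : X -> W).
Hypotheses (Hk : forall x, H (k x)) (Tt : forall x, T (t x)).

Lemma hilbert_lincomb s : H (lincomb k s).
Proof. by apply: (hilbert_sum hH) => p; exact: (hilbertZ hH). Qed.

Hypothesis dense : forall u (e : R), H u -> 0 < e ->
  exists s, hnorm ipH (u - lincomb k s) < e.
Variable M : R.
Hypothesis bounded : forall s,
  hnorm ipT (lincomb t s) <= M * hnorm ipH (lincomb k s).

Lemma bounded_lincombB s s' :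
  hnorm ipT (lincomb t s - lincomb t s') <=
  M * hnorm ipH (lincomb k s - lincomb k s').
Proof.
rewrite -scaleN1r -(scaleN1r (lincomb k s')) -!lincomb_scale -!lincomb_cat.
exact: bounded.
Qed.

(** [M] may be zero or negative, so errors are divided by [|M| + 1]. *)
Let bound_gt0 : 0 < `|M| + 1.
Proof. by rewrite ltr_wpDl. Qed.

Lemma bounded_lincombB_lt s s' r : 0 < r ->
  hnorm ipH (lincomb k s - lincomb k s') < r / (`|M| + 1) ->
  hnorm ipT (lincomb t s - lincomb t s') < r.
Proof.
move=> r0 h; apply: le_lt_trans (bounded_lincombB _ _) _.
have h0 := hnorm_ge0 (ip := ipH) (lincomb k s - lincomb k s').
apply: (@le_lt_trans _ _ ((`|M| + 1) * hnorm ipH (lincomb k s - lincomb k s'))).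
  by rewrite ler_wpM2r // (le_trans (ler_norm M)) // lerDl.
by rewrite mulrC -ltr_pdivlMr.
Qed.

(* the closure of the graph of [k x |-> t x]; boundedness makes it functional *)
Let graph u v := [/\ H u, T v & forall e, 0 < e -> exists s,
  hnorm ipH (u - lincomb k s) < e /\ hnorm ipT (v - lincomb t s) < e].

Let Tlc s : T (lincomb t s).
Proof. by apply: (hilbert_sum hT) => p; exact: (hilbertZ hT). Qed.

(** Combinations approximating [u] form a Cauchy sequence; [bounded] carries this over to their
    images, and [T] is complete. *)
Let graph_total u : H u -> exists v, graph u v.
Proof.
move=> Hu.
have happ n : exists s, hnorm ipH (u - lincomb k s) < n.+1%:R^-1.
  by apply: dense; rewrite ?invr_gt0.
have [s hs] := choice happ.
have small (r : R) : 0 < r -> exists N, forall n, (N <= n)%N ->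
    hnorm ipH (u - lincomb k (s n)) < r.
  move=> r0; have := @near_infty_natSinv_lt R (PosNum r0).
  by move=> [N _ hN]; exists N => n /hN; exact: lt_trans.
have [v Tv vs] : exists2 l, T l &
    (fun n => hnorm ipT (lincomb t (s n) - l)) @ \oo --> (0 : R).
  apply: (hilbert_complete hT) => [n|r r0]; first exact: Tlc.
  have r1 : 0 < r / (`|M| + 1) / 2 by rewrite !divr_gt0.
  have [N hN] := small _ r1; exists N => m n Nm Nn.
  apply: bounded_lincombB_lt => //.
  have := hnorm_triangleB hH (hilbert_lincomb (s m)) Hu (hilbert_lincomb (s n)).
  rewrite (hnormBC hH (hilbert_lincomb _) Hu).
  by have := hN _ Nm; have := hN _ Nn; lra.
exists v; split => // e e0; have [N hN] := small _ e0.
have [N' hN'] := hnorm_cvg_lt vs e0; exists (s (maxn N N')); split.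
  exact/hN/leq_maxl.
by rewrite (hnormBC hT Tv (Tlc _)); exact/hN'/leq_maxr.
Qed.

Let graph_linear a u u' v v' : graph u v -> graph u' v' ->
  graph (a *: u + u') (a *: v + v').
Proof.
move=> [Hu Tv h] [Hu' Tv' h']; split; first exact: (hilbert_linear hH).
  exact: (hilbert_linear hT).
(* The 1 is added because [a] may be 0. *)
move=> e e0; have a0 : 0 < modc a + 1 by rewrite ltr_wpDl ?modc_ge0.
have e2 : 0 < e / 2 by rewrite divr_gt0.
have [s [s1 s2]] := h (e / 2 / (modc a + 1)) (divr_gt0 e2 a0).
have [s' [s1' s2']] := h' _ e2.
exists (scale_coefs a s ++ s'); rewrite !lincomb_cat !lincomb_scale.
have key (V' : lmodType R[i]) (H' : set V') ip' (x x' y y' : V') :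
    is_hilbert H' ip' -> H' (x - y) -> H' (x' - y') ->
    hnorm ip' (x - y) < e / 2 / (modc a + 1) ->
    hnorm ip' (x' - y') < e / 2 ->
    hnorm ip' (a *: x + x' - (a *: y + y')) < e.
  move=> hH' Hxy Hxy' l1 l2.
  rewrite opprD addrACA -scalerBr.
  apply: le_lt_trans (hnorm_triangle hH' (hilbertZ hH' a Hxy) Hxy') _.
  rewrite (hnormZ hH') //.
  suff : modc a * hnorm ip' (x - y) <= e / 2 by lra.
  have n0 := hnorm_ge0 (ip := ip') (x - y).
  move: (ltW l1); rewrite ler_pdivlMr //; nra.
split; [apply: (key _ _ _ _ _ _ _ hH)|apply: (key _ _ _ _ _ _ _ hT)] => //.
- exact: (hilbertB hH Hu (hilbert_lincomb _)).
- exact: (hilbertB hH Hu' (hilbert_lincomb _)).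
- exact: (hilbertB hT Tv (Tlc _)).
- exact: (hilbertB hT Tv' (Tlc _)).
Qed.

Let graph_bounded u v : graph u v -> hnorm ipT v <= `|M| * hnorm ipH u.
Proof.
move=> [Hu Tv h]; apply/ler_addgt0Pr => e e0.
(* The error in [H] is multiplied by [|M|] and the error in [T] by 1, hence the share
   [e / (|M| + 1)]. *)
have [s [s1 s2]] := h _ (divr_gt0 e0 bound_gt0).
have := hnorm_triangle hT (hilbertB hT Tv (Tlc s)) (Tlc s); rewrite subrK.
have := hnorm_triangle hH (hilbertN hH (hilbertB hH Hu (hilbert_lincomb s))) Hu.
rewrite (hnormN hH (hilbertB hH Hu (hilbert_lincomb s))) opprB subrK.
have := bounded s; have := hnorm_ge0 (ip := ipH) (lincomb k s).
have := ler_norm M; have := normr_ge0 M.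
move: s1 s2; rewrite !ltr_pdivlMr //.
set A := hnorm ipH (u - _); set B := hnorm ipT (v - _).
set K := hnorm ipH (lincomb k s); set L := hnorm ipT (lincomb t s).
set U := hnorm ipH u; set Y := hnorm ipT v.
move=> hA hB m0 mM K0 hL hK hY.
have hLM : L <= `|M| * K by apply: le_trans hL _; exact: ler_wpM2r.
have : `|M| * K <= `|M| * (A + U) by exact: ler_wpM2l.
have B0 : 0 <= B := hnorm_ge0 _.
have A0 : 0 <= A := hnorm_ge0 _.
have e1 : e / (`|M| + 1) * (`|M| + 1) = e.
  by rewrite divfK // gt_eqF.
nra.
Qed.

Lemma bounded_linear_extension :
  exists D, is_bounded_linear H ipH T ipT D /\ forall x, D (k x) = t x.
Proof.
(* The difference of two values over [u] is a value over 0, and [graph_bounded] makes its norm 0. *)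
have uniq u v v' : graph u v -> graph u v' -> v = v'.
  move=> g g'; have := graph_bounded (graph_linear (-1) g g').
  have -> : -1 *: u + u = 0 by rewrite scaleN1r addNr.
  rewrite (hnorm0 hH) mulr0 => h.
  have [_ Tv _] := g; have [_ Tv' _] := g'.
  have T1 : T (-1 *: v + v') by exact: (hilbert_linear hT).
  have /(hnorm_eq0 hT T1)/eqP : hnorm ipT (-1 *: v + v') = 0.
    by apply/eqP; rewrite eq_le h hnorm_ge0.
  by rewrite scaleN1r addrC subr_eq0 => /eqP.
pose D u := xget 0 [set v | graph u v].
have DP u : H u -> graph u (D u).
  by move=> /graph_total[v g]; exact: (@xgetPex _ 0 [set v | graph u v]
    (ex_intro _ v g)).
exists D; split; last first.
  move=> x; apply: (uniq (k x)); first exact: DP.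
  split => // e e0; exists [:: (1, x)].
  by rewrite !lincomb1 !subrr (hnorm0 hH) (hnorm0 hT).
split.
- by move=> u /DP[].
- move=> a u v Hu Hv; apply: (uniq (a *: u + v)).
    exact/DP/(hilbert_linear hH).
  by apply: graph_linear; exact: DP.
- by exists `|M| => u Hu; exact/graph_bounded/DP.
Qed.

End Extension.

(** * Real and complex integrals *)

Section RealIntegration.
Context {d : measure_display} {Y : measurableType d} {R : realType}.
Variable mu : {measure set Y -> \bar R}.
Local Notation rint f := (mu.-integrable setT (fun y => (f y)%:E)).
Implicit Types f g : Y -> R.

Lemma rint_measurable f : rint f -> measurable_fun setT f.
Proof. by move=> /integrableP[/measurable_EFinP]. Qed.

Lemma rint_le f g : measurable_fun setT f -> (forall y, `|f y| <= g y) ->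
  rint g -> rint f.
Proof.
move=> mf fg ig; apply: (le_integrable measurableT _ _ ig) => /=.
  exact/measurable_EFinP.
by move=> y _; rewrite lee_fin (le_trans (fg y)) // ler_norm.
Qed.

Lemma rintD f g : rint f -> rint g -> rint (fun y => f y + g y).
Proof. by move=> fi gi; exact: (integrableD measurableT fi gi). Qed.

Lemma rintB f g : rint f -> rint g -> rint (fun y => f y - g y).
Proof. by move=> fi gi; exact: (integrableB measurableT fi gi). Qed.

Lemma rintZ (a : R) f : rint f -> rint (fun y => a * f y).
Proof. by move=> fi; exact: (integrableZl measurableT a fi). Qed.

Lemma rint_norm f : rint f -> rint (fun y => `|f y|).
Proof. by move=> fi; exact: (integrable_norm fi). Qed.

Lemma rint_ge0 f : measurable_fun setT f -> (forall y, 0 <= f y) ->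
  (\int[mu]_y (f y)%:E < +oo)%E -> rint f.
Proof.
move=> mf f0 fi; apply/integrableP; split; first exact/measurable_EFinP.
by under eq_integral do rewrite gee0_abs ?lee_fin //.
Qed.

Lemma rint_fin f : rint f -> (\int[mu]_y (f y)%:E = (\int[mu]_y f y)%:E)%E.
Proof. by move=> fi; rewrite /Rintegral fineK // integrable_fin_num. Qed.

Lemma eq_rint f g : f =1 g -> rint f -> rint g.
Proof. by move=> /funext ->. Qed.

Lemma Rintegral_eq0_ae f : rint f -> (forall y, 0 <= f y) ->
  \int[mu]_y f y = 0 -> {ae mu, forall y, f y = 0}.
Proof.
move=> fi f0 If; have mf := rint_measurable fi.
have mf' : measurable_fun setT (fun y => (f y)%:E) by exact/measurable_EFinP.
have /(ae_eq_integral_abs mu measurableT mf') : (\int[mu]_y `|(f y)%:E| = 0)%E.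
  under eq_integral do rewrite gee0_abs ?lee_fin //.
  by rewrite rint_fin // If.
by apply: filterS => y /(_ I) [].
Qed.

Lemma ae_eq_Rintegral f g : measurable_fun setT f -> measurable_fun setT g ->
  {ae mu, forall y, f y = g y} -> \int[mu]_y f y = \int[mu]_y g y.
Proof.
move=> mf mg fg; congr fine; apply: ae_eq_integral => //;
  [exact/measurable_EFinP|exact/measurable_EFinP|].
by apply: filterS fg => y ->.
Qed.

End RealIntegration.

Section ComplexIntegration.
Context {d : measure_display} {Y : measurableType d} {R : realType}.
Implicit Types f g : Y -> R[i].

Definition cmeasurable f :=
  measurable_fun setT (fun y => complex.Re (f y)) /\
  measurable_fun setT (fun y => complex.Im (f y)).

Lemma cmeasurable_modc f : cmeasurable f ->
  measurable_fun setT (fun y => modc (f y)).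
Proof.
move=> [mr mi]; rewrite (_ : (fun _ => _) = Num.sqrt \o
    (fun y => complex.Re (f y) ^+ 2 + complex.Im (f y) ^+ 2)); last first.
  by apply/funext => y; rewrite modcE.
apply: measurableT_comp; first by apply: continuous_measurable_fun; exact: sqrt_continuous.
by apply: measurable_funD; exact: measurable_funX.
Qed.

Lemma cmeasurableD f g : cmeasurable f -> cmeasurable g ->
  cmeasurable (fun y => f y + g y).
Proof.
move=> [fr fi] [gr gi]; split; under eq_fun do rewrite ?ReD ?ImD;
  exact: measurable_funD.
Qed.

Lemma cmeasurableM f g : cmeasurable f -> cmeasurable g ->
  cmeasurable (fun y => f y * g y).
Proof.
move=> [fr fi] [gr gi]; split.
  rewrite (_ : (fun _ => _) = fun y => complex.Re (f y) * complex.Re (g y) -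
    complex.Im (f y) * complex.Im (g y)); last first.
    by apply/funext => y; case: (f y) => ? ?; case: (g y).
  by apply: measurable_funB; exact: measurable_funM.
rewrite (_ : (fun _ => _) = fun y => complex.Re (f y) * complex.Im (g y) +
  complex.Im (f y) * complex.Re (g y)); last first.
  by apply/funext => y; case: (f y) => ? ?; case: (g y).
by apply: measurable_funD; exact: measurable_funM.
Qed.

Lemma cmeasurableJ f : cmeasurable f -> cmeasurable (fun y => (f y)^*%C).
Proof.
move=> [fr fi]; split.
  by rewrite (_ : (fun _ => _) = fun y => complex.Re (f y)) //; apply/funext
    => y; case: (f y).
rewrite (_ : (fun _ => _) = fun y => - complex.Im (f y)); last first.
  by apply/funext => y; case: (f y).
exact: measurableT_comp.
Qed.

Lemma cmeasurable_cst (a : R[i]) : cmeasurable (fun=> a).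
Proof. by split; exact: measurable_cst. Qed.

Lemma cmeasurable_real (f : Y -> R) : measurable_fun setT f ->
  cmeasurable (fun y => (f y)%:C%C).
Proof. by move=> mf; split => //=; exact: measurable_cst. Qed.

Lemma cmeasurableZ (a : R[i]) f : cmeasurable f ->
  cmeasurable (fun y => a * f y).
Proof. by apply: cmeasurableM; exact: cmeasurable_cst. Qed.

Variable mu : {measure set Y -> \bar R}.
Local Notation rint f := (mu.-integrable setT (fun y => (f y)%:E)).

Lemma cintegrable_measurable f : cintegrable mu f -> cmeasurable f.
Proof. by move=> [/rint_measurable ? /rint_measurable ?]. Qed.

Lemma cintegrable_le f (g : Y -> R) : cmeasurable f ->
  (forall y, modc (f y) <= g y) -> rint g -> cintegrable mu f.
Proof.
move=> [mr mi] fg ig; split; apply: rint_le ig => // y; apply: le_trans (fg y).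
  exact: le_norm_Re.
exact: le_norm_Im.
Qed.

Lemma cintegrable_modc f : cintegrable mu f -> rint (fun y => modc (f y)).
Proof.
move=> fi; have mf := cintegrable_measurable fi; have [f1 f2] := fi.
apply: rint_le (rintD (rint_norm f1) (rint_norm f2)).
  exact: cmeasurable_modc.
move=> y; rewrite ger0_norm ?modc_ge0 //.
rewrite -(ler_pXn2r (n := 2)) ?nnegrE ?modc_ge0 ?addr_ge0 //.
by rewrite modc_sqr sqrrD !real_normK ?num_real // lerD2r lerDl mulrn_wge0 ?mulr_ge0.
Qed.

Lemma cintegrable_bounded f g (M : R) : cmeasurable g ->
  (forall y, modc (g y) <= M) -> cintegrable mu f ->
  cintegrable mu (fun y => f y * g y).
Proof.
move=> mg gM fi; apply: cintegrable_le (rintZ M (cintegrable_modc fi)).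
  by apply: cmeasurableM => //; exact: cintegrable_measurable.
by move=> y; rewrite modcM mulrC ler_wpM2r // modc_ge0.
Qed.

Lemma cintegrableD f g : cintegrable mu f -> cintegrable mu g ->
  cintegrable mu (fun y => f y + g y).
Proof.
move=> [fr fi] [gr gi]; split; under eq_fun do rewrite ?ReD ?ImD; exact: rintD.
Qed.

Lemma cintegrableZ (a : R[i]) f : cintegrable mu f ->
  cintegrable mu (fun y => a * f y).
Proof.
move=> fi; under eq_fun do rewrite mulrC.
by apply: (cintegrable_bounded (M := modc a)) fi => //; exact: cmeasurable_cst.
Qed.

Lemma cintegralD f g : cintegrable mu f -> cintegrable mu g ->
  cintegral mu (fun y => f y + g y) = cintegral mu f + cintegral mu g.
Proof.
move=> [fr fi] [gr gi]; rewrite /cintegral.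
under eq_Rintegral do rewrite ReD.
under [X in Complex _ X]eq_Rintegral do rewrite ImD.
by rewrite !RintegralD.
Qed.

Lemma cintegralZ (a : R[i]) f : cintegrable mu f ->
  cintegral mu (fun y => a * f y) = a * cintegral mu f.
Proof.
move=> [fr fi]; rewrite /cintegral; case: a => a b.
transitivity (Complex
  (\int[mu]_y (a * complex.Re (f y) - b * complex.Im (f y)))
  (\int[mu]_y (a * complex.Im (f y) + b * complex.Re (f y)))).
  by congr Complex; apply: eq_Rintegral => y _; case: (f y).
rewrite RintegralB ?RintegralD ?RintegralZl //; exact: rintZ.
Qed.

Lemma cintegralJ f : cintegrable mu f ->
  cintegral mu (fun y => (f y)^*%C) = ((cintegral mu f)^*)%C.
Proof.
move=> [fr fi]; rewrite /cintegral /=; congr Complex.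
  by apply: eq_Rintegral => y _; case: (f y).
rewrite -mulN1r -RintegralZl //; apply: eq_Rintegral => y _.
by case: (f y) => a b /=; rewrite mulN1r.
Qed.

Lemma cintegral0 : cintegral mu (fun=> 0) = 0.
Proof. by rewrite /cintegral /Rintegral integral0. Qed.

Lemma cintegral_real (f : Y -> R) :
  cintegral mu (fun y => (f y)%:C%C) = (\int[mu]_y f y)%:C%C.
Proof. by rewrite /cintegral /= /Rintegral integral0. Qed.

Lemma ae_eq_cintegral f g : cmeasurable f -> cmeasurable g ->
  {ae mu, forall y, f y = g y} -> cintegral mu f = cintegral mu g.
Proof.
move=> [fr fi] [gr gi] fg; congr Complex; apply: ae_eq_Rintegral => //;
  by apply: filterS fg => y ->.
Qed.

End ComplexIntegration.

(** * Weighted square-integrable functions and their transforms *)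

Section WeightedL2.
Context {d : measure_display} {Y : measurableType d} {R : realType}.
Variables (mu : {measure set Y -> \bar R}) (w : Y -> R).
Local Notation rint f := (mu.-integrable setT (fun y => (f y)%:E)).
Hypotheses (w_gt0 : forall y, 0 < w y) (w_int : rint w).
Implicit Types h g : Y -> R[i].

Definition wL2 h : Prop :=
  cintegrable mu h /\ (\int[mu]_y (modc (h y) ^+ 2 / w y)%:E < +oo)%E.

Definition wdot h g : R[i] :=
  cintegral mu (fun y => h y * ((g y)^*)%C / ((w y)%:C)%C).

Definition wnorm2 h : R := \int[mu]_y (modc (h y) ^+ 2 / w y).

Lemma measurable_weightV : measurable_fun setT (fun y => (w y)^-1).
Proof.
rewrite (_ : (fun _ => _) = (fun x => x `^ (-1)) \o w); last first.
  by apply/funext => y /=; rewrite powR_inv1 // ltW.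
by apply: measurableT_comp; [exact: measurable_powR|exact: rint_measurable w_int].
Qed.

Lemma wdensity_ge0 h y : 0 <= modc (h y) ^+ 2 / w y.
Proof. by rewrite divr_ge0 ?sqr_ge0 // ltW. Qed.

Lemma measurable_wdensity h : cmeasurable h ->
  measurable_fun setT (fun y => modc (h y) ^+ 2 / w y).
Proof.
move=> mh; apply: measurable_funM; last exact: measurable_weightV.
exact/measurable_funX/cmeasurable_modc.
Qed.

Lemma wL2_measurable h : wL2 h -> cmeasurable h.
Proof. by move=> [/cintegrable_measurable]. Qed.

Lemma wL2_density h : wL2 h -> rint (fun y => modc (h y) ^+ 2 / w y).
Proof.
move=> [hi h2]; apply: rint_ge0 => //; last exact: wdensity_ge0.
by apply: measurable_wdensity; exact: cintegrable_measurable hi.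
Qed.

(* AM-GM, applied to the factors [s x^2 / v] and [v / s]. *)
Lemma le_weighted_sqr (x v s : R) : 0 < v -> 0 < s ->
  x <= s * (x ^+ 2 / v) + s^-1 * v.
Proof.
move=> v0 s0; rewrite -subr_ge0.
have -> : s * (x ^+ 2 / v) + s^-1 * v - x =
    ((s * x - v / 2) ^+ 2 + 3 / 4 * v ^+ 2) / (s * v).
  by field; rewrite !gt_eqF.
apply: divr_ge0; last by rewrite mulr_ge0 // ltW.
by rewrite addr_ge0 ?sqr_ge0 // mulr_ge0 ?sqr_ge0.
Qed.

(** Integrability of [h] comes for free: [le_weighted_sqr] with s = 1 bounds |h| by |h|^2 / w + w,
    and [w] is integrable. *)
Lemma wL2P h : cmeasurable h -> rint (fun y => modc (h y) ^+ 2 / w y) -> wL2 h.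
Proof.
move=> mh h2; split; last exact: (integrable_lty measurableT h2).
apply: cintegrable_le (rintD h2 w_int) => // y.
by have := @le_weighted_sqr (modc (h y)) (w y) 1 (w_gt0 y) ltr01;
  rewrite invr1 !mul1r.
Qed.

Lemma wL2_dominated h (f : Y -> R) : cmeasurable h -> rint f ->
  (forall y, modc (h y) ^+ 2 / w y <= f y) -> wL2 h.
Proof.
move=> mh fi hf; apply: wL2P => //; apply: rint_le fi.
  exact: measurable_wdensity.
by move=> y; rewrite ger0_norm ?wdensity_ge0.
Qed.

Lemma wL2_linear (a : R[i]) h g : wL2 h -> wL2 g ->
  wL2 (fun y => a * h y + g y).
Proof.
move=> Hh Hg.
apply: (wL2_dominated (f := fun y => 2 * modc a ^+ 2 * (modc (h y) ^+ 2 / w y) +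
    2 * (modc (g y) ^+ 2 / w y))).
- by apply: cmeasurableD; [apply: cmeasurableZ|]; exact: wL2_measurable.
- by apply: rintD; apply: rintZ; exact: wL2_density.
move=> y; have -> : 2 * modc a ^+ 2 * (modc (h y) ^+ 2 / w y) +
    2 * (modc (g y) ^+ 2 / w y) =
    (2 * modc (a * h y) ^+ 2 + 2 * modc (g y) ^+ 2) / w y.
  by rewrite modcM; ring.
rewrite ler_pM2r ?invr_gt0 // !modc_sqr ReD ImD.
have := sqr_ge0 (complex.Re (a * h y) - complex.Re (g y)).
have := sqr_ge0 (complex.Im (a * h y) - complex.Im (g y)).
set p := complex.Re (a * h y); set q := complex.Im (a * h y); lra.
Qed.

Lemma wL2B h g : wL2 h -> wL2 g -> wL2 (fun y => h y - g y).
Proof.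
move=> Hh Hg; under eq_fun do rewrite addrC -mulN1r; exact: wL2_linear.
Qed.

Lemma wdot_integrable h g : wL2 h -> wL2 g ->
  cintegrable mu (fun y => h y * ((g y)^*)%C / ((w y)%:C)%C).
Proof.
move=> Hh Hg; apply: cintegrable_le (rintD (wL2_density Hh) (wL2_density Hg)).
  apply: cmeasurableM.
    apply: cmeasurableM; first exact: wL2_measurable.
    exact/cmeasurableJ/wL2_measurable.
  by under eq_fun do rewrite -fmorphV; exact/cmeasurable_real/measurable_weightV.
move=> y; rewrite !modcM modcJ -fmorphV modc_real.
have v0 : 0 < (w y)^-1 by rewrite invr_gt0.
rewrite -[leRHS]mulrDl (ger0_norm (ltW v0)) ler_pM2r //.
have := modc_ge0 (h y); have := modc_ge0 (g y); nra.
Qed.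

Lemma wdot_measurable h g : cmeasurable h -> cmeasurable g ->
  cmeasurable (fun y => h y * ((g y)^*)%C / ((w y)%:C)%C).
Proof.
move=> mh mg; apply: cmeasurableM; first by apply/cmeasurableM/cmeasurableJ.
by under eq_fun do rewrite -fmorphV; exact/cmeasurable_real/measurable_weightV.
Qed.

Lemma wdot_linear a h h' g : wL2 h -> wL2 h' -> wL2 g ->
  wdot (fun y => a * h y + h' y) g = a * wdot h g + wdot h' g.
Proof.
move=> Hh Hh' Hg; rewrite /wdot -cintegralZ; last exact: wdot_integrable.
rewrite -cintegralD; [|apply: cintegrableZ|]; try exact: wdot_integrable.
by congr cintegral; apply/funext => y; rewrite !mulrDl !mulrA.
Qed.

Lemma wdot_conj h g : wL2 h -> wL2 g -> wdot g h = ((wdot h g)^*)%C.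
Proof.
move=> Hh Hg; rewrite /wdot -cintegralJ; last exact: wdot_integrable.
congr cintegral; apply/funext => y.
by rewrite -fmorphV !conjcM conjcK conjc_real [_^*%C * _]mulrC.
Qed.

Lemma wdot_self h : wdot h h = (wnorm2 h)%:C%C.
Proof.
rewrite /wdot /wnorm2 -cintegral_real; congr cintegral; apply/funext => y.
by rewrite mulcJE -fmorphV -rmorphM.
Qed.

Lemma wnorm2_ge0 h : 0 <= wnorm2 h.
Proof. by apply: Rintegral_ge0 => y _; exact: wdensity_ge0. Qed.

Lemma wnorm2_eq0 h : wL2 h -> wnorm2 h = 0 -> {ae mu, forall y, h y = 0}.
Proof.
move=> Hh /(Rintegral_eq0_ae (wL2_density Hh) (wdensity_ge0 h)).
apply: filterS => y /eqP; rewrite mulf_eq0 invr_eq0 (gt_eqF (w_gt0 y)) orbF.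
by rewrite sqrf_eq0 => /eqP; exact: modc_eq0.
Qed.

Lemma wdot_ae h h' g g' : wL2 h -> wL2 h' -> wL2 g -> wL2 g' ->
  {ae mu, forall y, h y = h' y} -> {ae mu, forall y, g y = g' y} ->
  wdot h g = wdot h' g'.
Proof.
move=> /wL2_measurable mh /wL2_measurable mh' /wL2_measurable mg
  /wL2_measurable mg' hh' gg'.
apply: ae_eq_cintegral; try exact: wdot_measurable.
by apply: filterS2 hh' gg' => y -> ->.
Qed.

Section Completeness.
Variable h : nat -> Y -> R[i].
Hypothesis Hh : forall n, wL2 (h n).

(** The free parameter replaces Cauchy-Schwarz: in [rapid_limit], s = 2^k against a squared norm
    below 4^-k makes both terms of order 2^-k. *)
Lemma cintegral_sub_bound u v s : wL2 u -> wL2 v -> 0 < s ->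
  (\int[mu]_y (modc (u y - v y))%:E <=
    (s * wnorm2 (fun y => u y - v y) + s^-1 * \int[mu]_y w y)%:E)%E.
Proof.
move=> Hu Hv s0; have Huv := wL2B Hu Hv.
have i1 := wL2_density Huv.
rewrite -!RintegralZl // -RintegralD //; [|exact: rintZ|exact: rintZ].
rewrite -rint_fin; last by apply: rintD; exact: rintZ.
apply: ge0_le_integral => //.
- by move=> y _; rewrite lee_fin modc_ge0.
- exact/measurable_EFinP/cmeasurable_modc/wL2_measurable.
- apply/measurable_EFinP/(@rint_measurable _ _ _ mu).
  by apply: rintD; exact: rintZ.
- by move=> y _; rewrite lee_fin le_weighted_sqr.
Qed.

Hypothesis cauchy : forall e, 0 < e -> exists N, forall m n,
  (N <= m)%N -> (N <= n)%N -> wnorm2 (fun y => h m y - h n y) < e.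

Lemma rapid_subsequence : exists nk : nat -> nat,
  (forall k, (k <= nk k)%N) /\
  forall k, wnorm2 (fun y => h (nk k.+1) y - h (nk k) y) < 4^-1 ^+ k.
Proof.
have /choice[N hN] : forall k, exists N, forall m n,
    (N <= m)%N -> (N <= n)%N -> wnorm2 (fun y => h m y - h n y) < 4^-1 ^+ k.
  by move=> k; apply: cauchy; rewrite exprn_gt0.
(* The sum makes [nk] nondecreasing and at least [N k]; the summand [k] ensures [k <= nk k]. *)
pose nk k := (k + \sum_(j < k.+1) N j)%N.
have leN k : (N k <= nk k)%N by rewrite /nk big_ord_recr /= addnA leq_addl.
exists nk; split => k; first exact: leq_addr.
apply: hN => //; apply: leq_trans (leN k) _.
by rewrite /nk [in leqRHS]big_ord_recr /= addSn leqW // leq_add2l leq_addr.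
Qed.

(** The Riesz-Fischer argument: the sum [G] of the moduli of successive differences has finite
    integral, so it is finite almost everywhere, and there the sequence converges absolutely. *)
Lemma rapid_limit (u : nat -> Y -> R[i]) : (forall k, wL2 (u k)) ->
  (forall k, wnorm2 (fun y => u k.+1 y - u k y) < 4^-1 ^+ k) ->
  exists2 g, cmeasurable g & {ae mu, forall y,
    (fun k => complex.Re (u k y)) @ \oo --> complex.Re (g y) /\
    (fun k => complex.Im (u k y)) @ \oo --> complex.Im (g y)}.
Proof.
move=> Hu hu; pose D k y := modc (u k.+1 y - u k y).
have mD k : measurable_fun setT (fun y => (D k y)%:E).
  exact/measurable_EFinP/cmeasurable_modc/wL2_measurable/wL2B.
have D0 k y : (0 <= (D k y)%:E)%E by rewrite lee_fin modc_ge0.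
pose G y := (\sum_(k <oo) (D k y)%:E)%E.
have mG : measurable_fun setT G by exact: ge0_emeasurable_sum.
have iG : (\int[mu]_y G y < +oo)%E.
  rewrite /G integral_nneseries //.
  pose W := \int[mu]_y w y.
  have W0 : 0 <= W by apply: Rintegral_ge0 => y _; exact: ltW.
  (* The bound is (1 + W) / 2^k, written with the denominator 2^(k+1) that [epsilon_trick0] sums. *)
  apply: (@le_lt_trans _ _ (\sum_(k <oo) ((2 * (1 + W)) / (2 ^ k.+1)%:R)%:E)%E).
    apply: lee_nneseries => [k *|k *]; first exact: integral_ge0.
    have s0 : 0 < 2 ^+ k :> R by rewrite exprn_gt0.
    apply: le_trans (cintegral_sub_bound (Hu _) (Hu _) s0) _.
    rewrite lee_fin natrX exprS invfM mulrACA divff // mul1r mulrDl mul1r.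
    rewrite -/W [W / _]mulrC lerD2r.
    have -> : (2 ^+ k)^-1 = 2 ^+ k * 4^-1 ^+ k :> R.
      rewrite -exprVn -exprMn; congr (_ ^+ _); lra.
    by rewrite ler_pM2l // ltW.
  by apply: le_lt_trans (epsilon_trick0 _ _) (ltry _); rewrite mulr_ge0 // addr_ge0.
have aG : {ae mu, forall y, (G y < +oo)%E}.
  have : mu.-integrable setT G.
    apply/integrableP; split => //.
    by under eq_integral do rewrite gee0_abs ?nneseries_ge0 //.
  by move/(integrable_ae measurableT); apply: filterS => y /(_ I); rewrite ltey_eq => ->.
have cv (f : nat -> R) y : (G y < +oo)%E ->
    (forall k, `|f k.+1 - f k| <= D k y) -> cvgn f.
  move=> Gy fD.
  have -> : f = (fun n => f 0%N + series (fun k => f k.+1 - f k) n).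
    by apply/funext => n; rewrite /series /= telescope_sumr // addrC subrK.
  apply: is_cvgD; first exact: is_cvg_cst.
  apply: normed_cvg; apply: nondecreasing_is_cvgn.
    by apply/nondecreasing_seqP => n; rewrite -subr_ge0 seriesSB normr_ge0.
  exists (fine (G y)) => _ [n _ <-].
  have Gf : G y \is a fin_num by rewrite ge0_fin_numE // nneseries_ge0.
  rewrite -lee_fin fineK // /series /= -sumEFin.
  apply: le_trans (nneseries_lim_ge n _) => //.
  by rewrite big_mkord big_mkord; apply: lee_sum => i _; rewrite lee_fin.
(* The value 0 where [G] is infinite makes the limit an everywhere pointwise limit of measurable
   functions. *)
pose gr y := if (G y < +oo)%E then limn (fun k => complex.Re (u k y)) else 0.
pose gi y := if (G y < +oo)%E then limn (fun k => complex.Im (u k y)) else 0.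
have cvr y : (G y < +oo)%E -> (fun k => complex.Re (u k y)) @ \oo --> gr y.
  move=> Gy; rewrite /gr Gy; apply: (cv (fun k => complex.Re (u k y)) y) => // k.
  by rewrite -ReB le_norm_Re.
have cvi y : (G y < +oo)%E -> (fun k => complex.Im (u k y)) @ \oo --> gi y.
  move=> Gy; rewrite /gi Gy; apply: (cv (fun k => complex.Im (u k y)) y) => // k.
  by rewrite -ImB le_norm_Im.
have mT : measurable_fun setT (fun y => (G y < +oo)%E).
  by apply: measurable_fun_lte => //; exact: measurable_cst.
exists (fun y => Complex (gr y) (gi y)); last first.
  by apply: filterS aG => y Gy; split; [exact: cvr|exact: cvi].
split => /=.
- apply: (@measurable_fun_cvg _ _ _ _
    (fun k y => if (G y < +oo)%E then complex.Re (u k y) else 0)) => [k|y _].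
    apply: measurable_fun_ifT => //; exact: (wL2_measurable (Hu k)).1.
  have [Gy|Gy] := boolP (G y < +oo)%E; first exact: cvr.
  rewrite /gr (negbTE Gy); exact: cvg_cst.
- apply: (@measurable_fun_cvg _ _ _ _
    (fun k y => if (G y < +oo)%E then complex.Im (u k y) else 0)) => [k|y _].
    apply: measurable_fun_ifT => //; exact: (wL2_measurable (Hu k)).2.
  have [Gy|Gy] := boolP (G y < +oo)%E; first exact: cvi.
  rewrite /gi (negbTE Gy); exact: cvg_cst.
Qed.

(** Fatou's lemma along the convergent subsequence bounds the norm of [h m - g] by the Cauchy
    estimate. Membership of [g] then follows by writing it as [h N1 - (h N1 - g)]. *)
Lemma wL2_complete : exists2 g, wL2 g & forall e, 0 < e -> exists N, forall n,
  (N <= n)%N -> wnorm2 (fun y => h n y - g y) <= e.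
Proof.
have [nk [lek hk]] := rapid_subsequence.
have [g mg gcv] := rapid_limit (fun k => Hh (nk k)) hk.
have key m (e : R) N : (forall n, (N <= n)%N -> wnorm2 (fun y => h n y - h m y) <= e) ->
    (\int[mu]_y (modc (h m y - g y) ^+ 2 / w y)%:E <= e%:E)%E.
  move=> hN; pose F k y := (modc (h (nk k) y - h m y) ^+ 2 / w y)%:E.
  have mF k : measurable_fun setT (F k).
    exact/measurable_EFinP/measurable_wdensity/wL2_measurable/wL2B.
  have F0 k y : (0 <= F k y)%E by rewrite lee_fin (wdensity_ge0 (fun y => h (nk k) y - h m y)).
  have fat := fatou mu measurableT mF (fun k y _ => F0 k y).
  have le_e : (limn_einf (fun k => \int[mu]_y F k y) <= e%:E)%E.
    rewrite limn_einf_lim; apply: lime_le; first exact: is_cvg_einfs.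
    near=> n; apply: ge_ereal_inf.
    (* This index lies both in the tail that defines the infimum and in the range of the Cauchy
       estimate. *)
    exists (\int[mu]_y F (maxn n N) y)%E.
      by exists (maxn n N) => //=; exact: leq_maxl.
    rewrite rint_fin; last by apply: wL2_density; exact: wL2B.
    by rewrite lee_fin hN // (leq_trans _ (lek _)) // leq_maxr.
  apply: le_trans le_e; apply: le_trans fat.
  have mgm : cmeasurable (fun y => h m y - g y).
    apply: cmeasurableD; first exact: wL2_measurable.
    by under eq_fun do rewrite -mulN1r; exact: cmeasurableZ.
  apply: ae_ge0_le_integral => //.
  - by move=> y _; rewrite lee_fin (wdensity_ge0 (fun y => h m y - g y)).
  - exact/measurable_EFinP/measurable_wdensity.
  - by move=> y _; rewrite limn_einf_lim; apply: lime_ge;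
      [exact: is_cvg_einfs|near=> n; apply: le_ereal_inf_tmp => _ [k _ <-]].
  - apply: measurableT_comp => //; apply: measurable_fun_limn_esup => k.
    exact: measurableT_comp.
  apply: filterS gcv => y [cr ci] _.
  suff cF : F ^~ y @ \oo --> (modc (h m y - g y) ^+ 2 / w y)%:E.
    by rewrite (cvg_limn_einf_sup cF).1.
  apply: cvg_EFin; first by near=> k.
  rewrite (_ : fine \o _ = fun k => modc (h (nk k) y - h m y) ^+ 2 / w y) //.
  apply: cvgM; last exact: cvg_cst.
  have cR : (fun k => complex.Re (h (nk k) y - h m y)) @ \oo -->
      complex.Re (g y - h m y).
    rewrite ReB; under eq_fun do rewrite ReB.
    by apply: cvgB => //; exact: cvg_cst.
  have cI : (fun k => complex.Im (h (nk k) y - h m y)) @ \oo -->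
      complex.Im (g y - h m y).
    rewrite ImB; under eq_fun do rewrite ImB.
    by apply: cvgB => //; exact: cvg_cst.
  rewrite (_ : modc (h m y - g y) = modc (g y - h m y)); last by rewrite -modcN opprB.
  under eq_fun do rewrite modc_sqr.
  rewrite modc_sqr; apply: cvgD; rewrite !expr2; exact: cvgM.
have [N1 hN1] := cauchy ltr01.
have Hg1 : wL2 (fun y => h N1 y - g y).
  apply: wL2P.
    apply: cmeasurableD; first exact: wL2_measurable.
    by under eq_fun do rewrite -mulN1r; exact: cmeasurableZ.
  apply: rint_ge0.
  - apply: measurable_wdensity.
    apply: cmeasurableD; first exact: wL2_measurable.
    by under eq_fun do rewrite -mulN1r; exact: cmeasurableZ.
  - exact: wdensity_ge0.
  - apply: le_lt_trans (key N1 1 N1 _) (ltry _).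
    by move=> n Nn; exact/ltW/hN1.
have Hg : wL2 g.
  have := wL2B (Hh N1) Hg1.
  by rewrite (_ : (fun y => h N1 y - (h N1 y - g y)) = g) //; apply/funext => y; ring.
exists g => // e e0; have [N hN] := cauchy e0; exists N => n Nn.
rewrite -lee_fin -rint_fin; last by apply: wL2_density; exact: wL2B.
by apply: (key n e N) => k Nk; exact/ltW/hN.
Unshelve. all: by end_near.
Qed.

End Completeness.
End WeightedL2.

(** * Reproducing kernels *)

Section ReproducingKernel.
Context {R : realType} {X : Type}.
Variables (H : set (X -> R[i])) (ip : (X -> R[i]) -> (X -> R[i]) -> R[i]).
Hypothesis hH : is_hilbert H ip.
Variable k : X -> X -> R[i].
Hypothesis kP : is_kernel_section H ip k.

(** By Cauchy-Schwarz, evaluation at [x] is Lipschitz with constant the norm of [k x]; 1 is added to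
    divide safely. *)
Lemma kernel_section_rkhs : is_rkhs H ip.
Proof.
split => // x f Hf e e0; have [Hk kf] := kP.
have k0 : 0 < hnorm ip (k x) + 1 by rewrite ltr_wpDl // hnorm_ge0.
exists (e / (hnorm ip (k x) + 1)); first exact: divr_gt0.
move=> g Hg lt_d; have Hgf := hilbertB hH Hg Hf.
have -> : g x - f x = (g - f) x by [].
rewrite kf //; apply: le_lt_trans (cauchy_schwarz hH Hgf (Hk x)) _.
have n0 := hnorm_ge0 (ip := ip) (g - f).
move: lt_d; rewrite ltr_pdivlMr //; lra.
Qed.

(** A vector orthogonal to all kernel sections is a function that vanishes at every point. *)
Lemma kernel_section_dense f (e : R) : H f -> 0 < e ->
  exists s, hnorm ip (f - lincomb k s) < e.
Proof.
move=> Hf e0; have [Hk kf] := kP.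
have [||||d [s ->]] := @hilbert_dense _ _ _ _ hH
  [set u | exists s, u = lincomb k s] _ _ _ _ f e Hf e0.
- by move=> _ [s ->]; exact: (hilbert_lincomb hH Hk).
- by exists [::]; rewrite /lincomb big_nil.
- move=> a _ _ [s ->] [s' ->]; exists (scale_coefs a s ++ s').
  by rewrite lincomb_cat lincomb_scale.
- move=> t Ht ort; apply/funext => x; rewrite kf // ort //.
  by exists [:: (1, x)]; rewrite lincomb1.
by exists s.
Qed.

(** The difference of two sections at [x] is orthogonal to every element of [H], in particular to
    itself. *)
Lemma kernel_section_unique k' : is_kernel_section H ip k' -> k' = k.
Proof.
move=> [Hk' k'f]; have [Hk kf] := kP; apply/funext => x; apply/eqP.
have Hd := hilbertB hH (Hk' x) (Hk x); rewrite -subr_eq0; apply/eqP.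
apply: (ip_eq0 hH) => //; rewrite -[X in ip _ X]scale1r scalerBr !scale1r.
rewrite -[X in ip _ (_ + X)]scaleN1r (ipDr hH) ?(ipZr hH) //; last first.
  exact: (hilbertZ hH).
by rewrite -k'f // -kf // conjcN conjc1 mulN1r subrr.
Qed.

End ReproducingKernel.

(** * Hilbert spaces of transforms *)

Section WeightedTransform.
Context {d : measure_display} {Y : measurableType d} {R : realType} {X : Type}.
Variables (mu : {measure set Y -> \bar R}) (w : Y -> R) (e : X -> Y -> R[i]).
Local Notation rint f := (mu.-integrable setT (fun y => (f y)%:E)).

(** On the dual group with [e x a := a x], this definition and the next four unfold to
    [inv_fourier], [Hspace], [hat], [Hip] and [Hkernel]. *)
Definition transform (h : Y -> R[i]) (x : X) : R[i] :=
  cintegral mu (fun y => h y * e x y).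

Definition transform_space : set (X -> R[i]) :=
  [set transform h | h in wL2 mu w].

Definition transform_inv (f : X -> R[i]) : Y -> R[i] :=
  xget (fun=> 0) [set h | wL2 mu w h /\ transform h = f].

Definition transform_ip (f g : X -> R[i]) : R[i] :=
  cintegral mu (fun a =>
    transform_inv f a * ((transform_inv g a)^*)%C / ((w a)%:C)%C).

Definition transform_kernel (x y : X) : R[i] :=
  cintegral mu (fun a => ((w a)%:C)%C * ((e x a)^*)%C * e y a).

Hypotheses (w_gt0 : forall y, 0 < w y) (w_int : rint w).
Hypotheses (me : forall x, cmeasurable (e x)).
Hypotheses (e1 : forall x y, modc (e x y) = 1).

Lemma transform_integrable h x : cintegrable mu h ->
  cintegrable mu (fun y => h y * e x y).
Proof.
by apply: (cintegrable_bounded (M := 1)) => // y; rewrite e1.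
Qed.

Lemma transform_linear a h g : cintegrable mu h -> cintegrable mu g ->
  transform (fun y => a * h y + g y) = a *: transform h + transform g.
Proof.
move=> hi gi; apply/funext => x.
have -> : (a *: transform h + transform g) x =
  a * transform h x + transform g x by [].
rewrite /transform -cintegralZ; last exact: transform_integrable.
rewrite -cintegralD; last exact: transform_integrable.
  by congr cintegral; apply/funext => y; rewrite mulrDl mulrA.
exact/cintegrableZ/transform_integrable.
Qed.

(** Supplied by [char_transform_inj] on the group and by [square_transform_inj] on its square. It
    makes the choice in [transform_inv] immaterial. *)
Hypothesis transform_inj : forall h, cintegrable mu h ->
  (forall x, transform h x = 0) -> {ae mu, forall y, h y = 0}.

Lemma transform_invP h : wL2 mu w h ->
  wL2 mu w (transform_inv (transform h)) /\
  transform (transform_inv (transform h)) = transform h.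
Proof.
move=> Hh; exact: (@xgetPex _ (fun=> 0)
  [set g | wL2 mu w g /\ transform g = transform h]
  (ex_intro _ h (conj Hh erefl))).
Qed.

Lemma transform_invK h : wL2 mu w h ->
  {ae mu, forall y, transform_inv (transform h) y = h y}.
Proof.
move=> Hh; have [Hg gh] := transform_invP Hh.
have gh0 x : transform (fun y => transform_inv (transform h) y - h y) x = 0.
  have -> : transform (fun y => transform_inv (transform h) y - h y) =
      transform (fun y => -1 * h y + transform_inv (transform h) y).
    by congr transform; apply/funext => y; rewrite mulN1r addrC.
  by rewrite transform_linear ?gh ?scaleN1r ?addNr //; [exact: Hh.1|exact: Hg.1].
have := transform_inj (wL2B w_gt0 w_int Hg Hh).1 gh0.
by apply: filterS => y /eqP; rewrite subr_eq0 => /eqP.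
Qed.

Lemma transform_ipE h g : wL2 mu w h -> wL2 mu w g ->
  transform_ip (transform h) (transform g) = wdot mu w h g.
Proof.
move=> Hh Hg; apply: (wdot_ae w_gt0 w_int) => //.
- exact: (transform_invP Hh).1.
- exact: (transform_invP Hg).1.
- exact: transform_invK.
- exact: transform_invK.
Qed.

Lemma transform_hnorm h : wL2 mu w h ->
  hnorm transform_ip (transform h) = Num.sqrt (wnorm2 mu w h).
Proof. by move=> Hh; rewrite /hnorm transform_ipE // wdot_self. Qed.

Lemma transformB h g : wL2 mu w h -> wL2 mu w g ->
  transform h - transform g = transform (fun y => h y - g y).
Proof.
move=> Hh Hg; rewrite addrC -scaleN1r -transform_linear; [|exact: Hg.1|exact: Hh.1].
by congr transform; apply/funext => y; rewrite mulN1r addrC.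
Qed.

Lemma transform_hilbert : is_hilbert transform_space transform_ip.
Proof.
have wl h : wL2 mu w h -> cintegrable mu h by case.
have wL20 : wL2 mu w (fun=> 0).
  apply: (wL2_dominated w_gt0 w_int (f := w)) => //.
  by move=> y; rewrite modc0 expr0n mul0r ltW.
have transform0 : transform (fun=> 0) = 0.
  apply/funext => x; rewrite /transform; under eq_fun do rewrite mul0r.
  exact: cintegral0.
split.
- by exists (fun=> 0).
- move=> a _ _ [h Hh <-] [g Hg <-].
  exists (fun y => a * h y + g y); first exact: wL2_linear.
  by rewrite transform_linear //; exact: wl.
- move=> a _ _ _ [h Hh <-] [g Hg <-] [k Hk <-].
  rewrite -transform_linear; [|exact: wl|exact: wl].
  by rewrite !transform_ipE ?wdot_linear //; exact: wL2_linear.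
- by move=> _ _ [h Hh <-] [g Hg <-]; rewrite !transform_ipE // -wdot_conj.
- by move=> _ [h Hh <-]; rewrite transform_ipE // wdot_self ler0c wnorm2_ge0.
- move=> _ [h Hh <-]; rewrite transform_ipE // wdot_self => /eqP.
  rewrite (fmorph_eq0 (real_complex R)) => /eqP /(wnorm2_eq0 w_gt0 w_int Hh) h0.
  rewrite -transform0; apply/funext => x; apply: ae_eq_cintegral.
  + exact/cintegrable_measurable/transform_integrable/wl.
  + exact/cintegrable_measurable/transform_integrable/wl.
  + by apply: filterS h0 => y ->.
- move=> s Hs cs.
  have /choice[h hP] : forall n, exists h, wL2 mu w h /\ transform h = s n.
    by move=> n; have [h Hh hs] := Hs n; exists h.
  have Hh n := (hP n).1; have hs n := (hP n).2.
  have [|g Hg gh] := wL2_complete w_gt0 w_int Hh.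
    move=> r r0; have sr0 : 0 < Num.sqrt r by rewrite sqrtr_gt0.
    have [N hN] := cs _ sr0; exists N => m n Nm Nn.
    have := hN m n Nm Nn; rewrite -!hs transformB // transform_hnorm.
      by rewrite ltr_sqrt.
    exact: wL2B.
  exists (transform g); first by exists g.
  apply/cvgrPdist_le => r r0; have [N hN] := gh _ (exprn_gt0 2 r0).
  exists N => // n Nn; rewrite sub0r normrN -hs transformB // transform_hnorm.
    rewrite ger0_norm ?sqrtr_ge0 //; apply: le_trans (ler_wsqrtr (hN n Nn)) _.
    by rewrite sqrtr_sqr gtr0_norm.
  exact: wL2B.
Qed.

Lemma transform_kernel_wL2 x :
  wL2 mu w (fun a => ((w a)%:C)%C * ((e x a)^*)%C).
Proof.
apply: (wL2_dominated w_gt0 w_int (f := w)) => //.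
  apply: cmeasurableM; last exact/cmeasurableJ/me.
  exact/cmeasurable_real/(rint_measurable w_int).
move=> y; rewrite modcM modcJ e1 mulr1 modc_real ger0_norm; last exact: ltW.
by rewrite expr2 mulfK ?gt_eqF.
Qed.

(** The section at [x] is the transform of [w] times the conjugate of [e x]; this factor [w] cancels
    the weight of the inner product and leaves the integral that evaluates at [x]. *)
Lemma transform_kernel_section :
  is_kernel_section transform_space transform_ip transform_kernel.
Proof.
split => [x|x _ [h Hh <-]].
  exists (fun a => ((w a)%:C)%C * ((e x a)^*)%C); first exact: transform_kernel_wL2.
  by [].
have -> : transform_kernel x = transform (fun a => ((w a)%:C)%C * ((e x a)^*)%C).
  by [].
rewrite transform_ipE //; last exact: transform_kernel_wL2.
congr cintegral; apply/funext => a.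
have wa0 : (w a)%:C%C != 0 by rewrite (fmorph_eq0 (real_complex R)) gt_eqF.
by rewrite conjcM conjcK conjc_real; field.
Qed.

End WeightedTransform.

(** * Fubini's theorem and the tensor square *)

Section RealFubini.
Context {d1 d2 : measure_display} {T1 : measurableType d1}
  {T2 : measurableType d2} {R : realType}.
Variables (m1 : {sigma_finite_measure set T1 -> \bar R})
  (m2 : {sigma_finite_measure set T2 -> \bar R}).
Local Notation rint mu f := (mu.-integrable setT (fun y => (f y)%:E)).

(** An inner integral is extended-valued and may be infinite on a null set; [fine] alters it only
    there. *)
Lemma rint_fine (g : T1 -> \bar R) : m1.-integrable setT g ->
  rint m1 (fun x => fine (g x)) /\
  (\int[m1]_x fine (g x) = fine (\int[m1]_x g x)).
Proof.
move=> gi; have mg := measurable_int _ gi.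
have mf : measurable_fun setT (fun x => (fine (g x))%:E).
  by apply/measurable_EFinP; exact: measurableT_comp.
split; last first.
  congr fine; apply: ae_eq_integral => //.
  by apply: filterS (integrable_ae measurableT gi) => x /(_ I) gx _; rewrite fineK.
apply: le_integrable gi => //= x _.
by case: (g x) => [r||] //=; rewrite ?normr0 ?leey.
Qed.

Lemma real_fubini (f : T1 * T2 -> R) : rint (m1 \x m2)%E f ->
  rint m1 (fun x => \int[m2]_y f (x, y)) /\
  \int[m1]_x (\int[m2]_y f (x, y)) = \int[(m1 \x m2)%E]_z f z.
Proof.
move=> fi; have [i1 i2] := rint_fine (integrable_fubini_F fi).
by split => //; rewrite i2; congr fine; exact: integral12_prod_meas1.
Qed.

Lemma real_fubini_swap (f : T1 * T2 -> R) : rint (m1 \x m2)%E f ->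
  rint (m2 \x m1)%E (fun z => f (z.2, z.1)) /\
  \int[(m2 \x m1)%E]_z f (z.2, z.1) = \int[(m1 \x m2)%E]_z f z.
Proof.
move=> fi; have mf := rint_measurable fi.
have fi' : rint (m2 \x m1)%E (fun z => f (z.2, z.1)).
  apply/integrable12ltyP => /=.
    by apply/measurable_EFinP/(measurableT_comp mf)/measurable_fun_pair.
  by move/integrable21ltyP : (fi); apply; exact/measurable_EFinP.
split => //; congr fine.
by rewrite -(integral12_prod_meas1 fi') -(integral21_prod_meas1 fi).
Qed.

Lemma rint_prod (f : T1 -> R) (g : T2 -> R) : rint m1 f -> rint m2 g ->
  rint (m1 \x m2)%E (fun z => f z.1 * g z.2).
Proof.
move=> fi gi; have mf := rint_measurable fi; have mg := rint_measurable gi.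
apply/integrable12ltyP.
  apply/measurable_EFinP/measurable_funM.
    exact: (measurableT_comp mf measurable_fst).
  exact: (measurableT_comp mg measurable_snd).
under eq_integral => x _.
  rewrite /=; under eq_integral do rewrite normrM EFinM.
  rewrite ge0_integralZl_EFin //; last first.
    exact/measurable_EFinP/(rint_measurable (rint_norm gi)).
  rewrite (rint_fin (rint_norm gi)) -EFinM mulrC.
  over.
by apply: (integrable_lty measurableT); exact/rintZ/rint_norm.
Qed.

End RealFubini.

Section ComplexFubini.
Context {d1 d2 : measure_display} {T1 : measurableType d1}
  {T2 : measurableType d2} {R : realType}.
Variables (m1 : {sigma_finite_measure set T1 -> \bar R})
  (m2 : {sigma_finite_measure set T2 -> \bar R}).
Local Notation rint mu f := (mu.-integrable setT (fun y => (f y)%:E)).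

Lemma complex_fubini (f : T1 * T2 -> R[i]) : cintegrable (m1 \x m2)%E f ->
  cintegrable m1 (fun x => cintegral m2 (fun y => f (x, y))) /\
  cintegral m1 (fun x => cintegral m2 (fun y => f (x, y))) =
  cintegral (m1 \x m2)%E f.
Proof.
move=> [/real_fubini[fr1 fr2] /real_fubini[fi1 fi2]].
by split; [split|congr Complex].
Qed.

Lemma cmeasurable_fst (f : T1 -> R[i]) : cmeasurable f ->
  cmeasurable (fun z : T1 * T2 => f z.1).
Proof.
by move=> [fr fi]; split;
  [exact: (measurableT_comp fr measurable_fst)|
   exact: (measurableT_comp fi measurable_fst)].
Qed.

Lemma cmeasurable_snd (f : T2 -> R[i]) : cmeasurable f ->
  cmeasurable (fun z : T1 * T2 => f z.2).
Proof.
by move=> [fr fi]; split;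
  [exact: (measurableT_comp fr measurable_snd)|
   exact: (measurableT_comp fi measurable_snd)].
Qed.

Lemma complex_fubini_mul (f : T1 * T2 -> R[i]) (g : T1 -> R[i]) :
  cintegrable (m1 \x m2)%E f -> cmeasurable g -> (forall x, modc (g x) <= 1) ->
  cintegral m1 (fun x => cintegral m2 (fun y => f (x, y)) * g x) =
  cintegral (m1 \x m2)%E (fun z => f z * g z.1).
Proof.
move=> fi mg g1; have fgi : cintegrable (m1 \x m2)%E (fun z => f z * g z.1).
  by apply: (cintegrable_bounded (M := 1)) => //; exact: cmeasurable_fst.
have [i1 <-] := complex_fubini fgi; have [i2 _] := complex_fubini fi.
apply: ae_eq_cintegral.
- by apply: cmeasurableM => //; exact: cintegrable_measurable i2.
- exact: cintegrable_measurable i1.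
have [fr fim] := fi.
(* Only almost every section of [f] is integrable, so [g x] moves inside the inner integral only for
   almost every [x]. *)
apply: filterS2 (ae_integrable1 fr) (ae_integrable1 fim) => x fxr fxi /=.
rewrite mulrC -cintegralZ //; congr cintegral; apply/funext => y.
exact: mulrC.
Qed.

Lemma complex_fubini_swap (f : T1 * T2 -> R[i]) : cintegrable (m1 \x m2)%E f ->
  cintegrable (m2 \x m1)%E (fun z => f (z.2, z.1)) /\
  cintegral (m2 \x m1)%E (fun z => f (z.2, z.1)) = cintegral (m1 \x m2)%E f.
Proof.
move=> [/real_fubini_swap[fr1 fr2] /real_fubini_swap[fi1 fi2]].
by split; [split|congr Complex].
Qed.

Lemma cintegrable_prod (f : T1 -> R[i]) (g : T2 -> R[i]) :
  cintegrable m1 f -> cintegrable m2 g ->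
  cintegrable (m1 \x m2)%E (fun z => f z.1 * g z.2).
Proof.
move=> fi gi.
apply: cintegrable_le (rint_prod (cintegrable_modc fi) (cintegrable_modc gi)).
  apply: cmeasurableM.
    exact/cmeasurable_fst/cintegrable_measurable/fi.
  exact/cmeasurable_snd/cintegrable_measurable/gi.
by move=> z; rewrite modcM.
Qed.

Lemma cintegral_prod (f : T1 -> R[i]) (g : T2 -> R[i]) :
  cintegrable m1 f -> cintegrable m2 g ->
  cintegral (m1 \x m2)%E (fun z => f z.1 * g z.2) =
  cintegral m1 f * cintegral m2 g.
Proof.
move=> fi gi; rewrite -(complex_fubini (cintegrable_prod fi gi)).2 /=.
under eq_fun do rewrite cintegralZ // mulrC.
by rewrite cintegralZ // mulrC.
Qed.

(** The measurable sets over which [f] integrates to 0 form a Dynkin system, and rectangles are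
    stable under intersection and generate the product sigma-algebra. *)
Lemma rint_eq0_rectangles (f : T1 * T2 -> R) : rint (m1 \x m2)%E f ->
  (forall A B, measurable A -> measurable B ->
    \int[(m1 \x m2)%E]_z (\1_A z.1 * \1_B z.2 * f z) = 0) ->
  {ae (m1 \x m2)%E, forall z, f z = 0}.
Proof.
move=> fi f0; pose D := [set E : set (T1 * T2) | measurable E /\
  (\int[(m1 \x m2)%E]_(z in E) (f z)%:E = 0)%E].
pose rect : set (set (T1 * T2)) :=
  [set A `*` B | A in @measurable _ T1 & B in @measurable _ T2].
have mrect A B : measurable A -> measurable B -> measurable (A `*` B : set (T1 * T2)).
  by move=> mA mB; exact: measurableX.
have Drect : rect `<=` D.
  move=> _ [A mA [B mB <-]]; split; first exact: mrect.
  have iAB : (m1 \x m2)%E.-integrable (A `*` B) (EFin \o f).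
    by apply: integrableS fi => //; exact: mrect.
  have fin : (\int[(m1 \x m2)%E]_(z in A `*` B) (f z)%:E)%E \is a fin_num.
    by apply: integrable_fin_num => //; exact: mrect.
  rewrite -(fineK fin) -/(Rintegral _ _ _) Rintegral_mkcond; congr (_%:E).
  rewrite -[RHS](f0 A B mA mB).
  apply: eq_Rintegral => -[x y] _; rewrite /patch !indicE /=.
  have -> : ((x, y) \in A `*` B) = (x \in A) && (y \in B).
    by apply/idP/andP; rewrite !inE => -[].
  by case: (x \in A); case: (y \in B); rewrite ?mul1r ?mul0r ?mulr0.
have DT : dynkin D.
  split.
  - have : D (setT `*` setT) by apply: Drect; exists setT => //; exists setT.
    by rewrite setXTT.
  - move=> E [mE E0]; split; first exact: measurableC.
    have [_] : D (setT `*` setT) by apply: Drect; exists setT => //; exists setT.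
    rewrite setXTT -(setUv E) integral_setU_EFin //; last 3 first.
    + exact: measurableC.
    + by rewrite setUv; exact: rint_measurable fi.
    + exact/disj_setPCl.
    by rewrite E0 add0e.
  - move=> F tF DF; have mF k : measurable (F k) by exact: (DF k).1.
    split; first exact: bigcup_measurable.
    rewrite integral_bigcup //; last first.
      by apply: integrableS fi => //; exact: bigcup_measurable.
    by rewrite eseries0 // => k _ _; exact: (DF k).2.
have : ae_eq (m1 \x m2)%E setT (EFin \o f) (cst 0%E).
  apply: integral_ae_eq => //= E _ mE; rewrite integral0.
  suff : D E by case.
  have rectI : setI_closed rect.
    move=> _ _ [A mA [B mB <-]] [A' mA' [B' mB' <-]].
    exists (A `&` A'); first exact: measurableI.
    by exists (B `&` B'); [exact: measurableI|rewrite setXI].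
  have /dynkin_lambda_system lD := DT.
  apply: (lambda_system_subset rectI lD Drect) => //.
  by rewrite -measurable_prod_measurableType.
by apply: filterS => z /(_ I) [].
Qed.

End ComplexFubini.

(** * The tensor square as a space of transforms in two variables *)

Section TensorSquare.
Context {d : measure_display} {Y : measurableType d} {R : realType} {X : Type}.
Variables (mu : {sigma_finite_measure set Y -> \bar R}) (w : Y -> R).
Variable e : X -> Y -> R[i].
Local Notation rint f := (mu.-integrable setT (fun y => (f y)%:E)).
Hypotheses (w_gt0 : forall y, 0 < w y) (w_int : rint w).
Hypotheses (me : forall x, cmeasurable (e x)).
Hypotheses (e1 : forall x y, modc (e x y) = 1).
Hypothesis e_inj : forall h, cintegrable mu h ->
  (forall x, transform mu e h x = 0) -> {ae mu, forall y, h y = 0}.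

Local Notation mu2 := (mu \x mu)%E.
Local Notation H := (transform_space mu w e).
Local Notation ip := (transform_ip mu w e).
Local Notation k := (transform_kernel mu w e).

Definition square_weight (z : Y * Y) : R := w z.1 * w z.2.

Definition square_char (p : X * X) (z : Y * Y) : R[i] := e p.1 z.1 * e p.2 z.2.

Definition square_tensor (f g : X -> R[i]) (p : X * X) : R[i] := f p.1 * g p.2.

Local Notation H2 := (transform_space mu2 square_weight square_char).
Local Notation ip2 := (transform_ip mu2 square_weight square_char).

Lemma square_weight_gt0 z : 0 < square_weight z.
Proof. exact: mulr_gt0. Qed.

Lemma square_weight_integrable :
  mu2.-integrable setT (fun z => (square_weight z)%:E).
Proof. exact: rint_prod. Qed.

Lemma square_char_measurable p : cmeasurable (square_char p).
Proof.
by apply: cmeasurableM; [exact: cmeasurable_fst|exact: cmeasurable_snd].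
Qed.

Lemma square_char_norm1 p z : modc (square_char p z) = 1.
Proof. by rewrite modcM !e1 mulr1. Qed.

Lemma cmeasurable_indic (A : set Y) : measurable A ->
  cmeasurable (fun y => (\1_A y)%:C%C : R[i]).
Proof. by move=> mA; exact/cmeasurable_real/measurable_indic. Qed.

Lemma modc_indic_le1 (A : set Y) y : modc ((\1_A y)%:C%C : R[i]) <= 1.
Proof. by rewrite modc_real indicE; case: (_ \in _); rewrite ?normr1 ?normr0. Qed.

(** Integrating out the second variable leaves a function of the first whose transform is 0. It
    vanishes almost everywhere, so the character can be replaced by an indicator. *)
Lemma transform_inj_section (f : Y * Y -> R[i]) : cintegrable mu2 f ->
  (forall x, cintegral mu2 (fun z => f z * e x z.1) = 0) ->
  forall A, measurable A -> cintegral mu2 (fun z => f z * (\1_A z.1)%:C%C) = 0.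
Proof.
move=> fi f0 A mA; have [Fi _] := complex_fubini fi.
have F0 : {ae mu, forall x, cintegral mu (fun y => f (x, y)) = 0}.
  apply: e_inj => // x; rewrite /transform complex_fubini_mul // => y.
  by rewrite e1.
have mA1 := cmeasurable_indic mA.
rewrite -(complex_fubini_mul fi mA1 (modc_indic_le1 A)).
rewrite -[RHS](cintegral0 mu); apply: ae_eq_cintegral.
- by apply: cmeasurableM => //; exact: cintegrable_measurable Fi.
- exact: cmeasurable_cst.
- by apply: filterS F0 => x ->; rewrite mul0r.
Qed.

(** Characters are traded for indicators one variable at a time: first in [z.1], with
    [h z * e y z.2] as the function, then in [z.2] after a swap, with [hA]. *)
Lemma square_transform_inj h : cintegrable mu2 h ->
  (forall p, transform mu2 square_char h p = 0) ->
  {ae mu2, forall z, h z = 0}.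
Proof.
move=> hi h0.
have rect0 A B : measurable A -> measurable B -> cintegral mu2
    (fun z => h z * (\1_A z.1)%:C%C * (\1_B z.2)%:C%C) = 0.
  move=> mA mB; pose hA z := h z * (\1_A z.1)%:C%C.
  have hAi : cintegrable mu2 hA.
    apply: (cintegrable_bounded (M := 1)) => //.
      by apply: (cmeasurable_fst (f := fun y => (\1_A y)%:C%C)); exact: cmeasurable_indic.
    by move=> z; exact: modc_indic_le1.
  have hA0 y : cintegral mu2 (fun z => hA z * e y z.2) = 0.
    transitivity (cintegral mu2
        (fun z => h z * e y z.2 * (\1_A z.1)%:C%C : R[i])).
      by congr cintegral; apply/funext => z; rewrite /hA mulrAC.
    apply: transform_inj_section => //.
      apply: (cintegrable_bounded (M := 1)) => //; first exact: cmeasurable_snd.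
      by move=> z; rewrite e1.
    move=> x; rewrite -[RHS](h0 (x, y)); congr cintegral; apply/funext => z.
    by rewrite /square_char mulrAC mulrA.
  have [hAi' _] := complex_fubini_swap hAi.
  have hAe y : cintegrable mu2 (fun z => hA z * e y z.2).
    apply: (cintegrable_bounded (M := 1)) => //; first exact: cmeasurable_snd.
    by move=> z; rewrite e1.
  have hAB : cintegrable mu2 (fun z => hA z * (\1_B z.2)%:C%C).
    apply: (cintegrable_bounded (M := 1)) => //.
      by apply: (cmeasurable_snd (f := fun y => (\1_B y)%:C%C)); exact: cmeasurable_indic.
    by move=> z; exact: modc_indic_le1.
  rewrite -(complex_fubini_swap hAB).2 /=.
  apply: (transform_inj_section hAi') => // y.
  exact: etrans (complex_fubini_swap (hAe y)).2 (hA0 y).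
have [hr him] := hi.
have real_rect A B z : h z * (\1_A z.1)%:C%C * (\1_B z.2)%:C%C =
    Complex (\1_A z.1 * \1_B z.2 * complex.Re (h z))
      (\1_A z.1 * \1_B z.2 * complex.Im (h z)).
  by case: (h z) => a b /=; rewrite -!complexr0 /=; apply/eqP;
    rewrite eq_complex /=; apply/andP; split; apply/eqP; ring.
have r0 : {ae mu2, forall z, complex.Re (h z) = 0}.
  apply: rint_eq0_rectangles => // A B mA mB.
  have := rect0 A B mA mB; under eq_fun do rewrite real_rect.
  by move=> [].
have i0 : {ae mu2, forall z, complex.Im (h z) = 0}.
  apply: rint_eq0_rectangles => // A B mA mB.
  have := rect0 A B mA mB; under eq_fun do rewrite real_rect.
  by move=> [].
by apply: filterS2 r0 i0 => z; case: (h z) => a b /= -> ->.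
Qed.

Lemma square_tensor_transform h g : cintegrable mu h -> cintegrable mu g ->
  square_tensor (transform mu e h) (transform mu e g) =
  transform mu2 square_char (fun z => h z.1 * g z.2).
Proof.
move=> hi gi; apply/funext => p; rewrite /square_tensor /transform.
rewrite -cintegral_prod; [|exact: transform_integrable|exact: transform_integrable].
by congr cintegral; apply/funext => z; rewrite /square_char mulrACA.
Qed.

Lemma square_wL2 h g : wL2 mu w h -> wL2 mu w g ->
  wL2 mu2 square_weight (fun z => h z.1 * g z.2).
Proof.
move=> Hh Hg; apply: (wL2P square_weight_gt0 square_weight_integrable).
  by apply: cmeasurableM; [apply: cmeasurable_fst|apply: cmeasurable_snd];
    apply: wL2_measurable; eassumption.
apply: eq_rint (rint_prod (wL2_density w_gt0 w_int Hh)
  (wL2_density w_gt0 w_int Hg)) => z.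
by rewrite modcM /square_weight exprMn invfM mulrACA.
Qed.

Lemma transform_space_square_tensor :
  is_hilbert_tensor H ip H ip H2 ip2 square_tensor.
Proof.
have c2 h : wL2 mu w h -> cintegrable mu h by case.
have hilb2 : is_hilbert H2 ip2.
  apply: transform_hilbert.
  - exact: square_weight_gt0.
  - exact: square_weight_integrable.
  - exact: square_char_measurable.
  - exact: square_char_norm1.
  - exact: square_transform_inj.
split=> //.
- move=> _ _ [h Hh <-] [g Hg <-]; exists (fun z => h z.1 * g z.2).
    exact: square_wL2.
  by rewrite square_tensor_transform //; exact: c2.
- move=> a u u' v _ _ _; apply/funext => p.
  by rewrite /square_tensor !fctE mulrDl -scalerAl.
- move=> a u v v' _ _ _; apply/funext => p.
  by rewrite /square_tensor !fctE mulrDr; congr (_ + _); exact: mulrCA.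
- move=> _ _ _ _ [h Hh <-] [h' Hh' <-] [g Hg <-] [g' Hg' <-].
  rewrite !square_tensor_transform; try exact: c2.
  rewrite (transform_ipE square_weight_gt0 square_weight_integrable
    square_char_measurable square_char_norm1 square_transform_inj);
    try exact: square_wL2.
  rewrite !transform_ipE // /wdot -cintegral_prod; try exact: wdot_integrable.
  congr cintegral; apply/funext => z.
  by rewrite /square_weight conjcM rmorphM invfM /=; ring.
(* The kernel section of the square at [(x, y)] is the elementary tensor of [k x] and [k y], so
   density of kernel sections suffices. *)
- move=> t r Ht r0.
  have kP2 := transform_kernel_section square_weight_gt0 square_weight_integrable
    square_char_measurable square_char_norm1 square_transform_inj.
  have [Hk _] := transform_kernel_section w_gt0 w_int me e1 e_inj.
  have [s hs] := kernel_section_dense hilb2 kP2 Ht r0.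
  exists [seq (p.1 *: k p.2.1, k p.2.2) | p <- s]; split.
    move=> q; elim: (s) => [//|p s' IH] /=; rewrite inE => /orP[/eqP ->|/IH //].
    split; last exact: Hk.
    by apply: (hilbertZ (transform_hilbert w_gt0 w_int me e1 e_inj)); exact: Hk.
  suff <- : lincomb (transform_kernel mu2 square_weight square_char) s =
    \sum_(p <- [seq (p.1 *: k p.2.1, k p.2.2) | p <- s]) square_tensor p.1 p.2.
    by [].
  rewrite /lincomb big_map; apply: eq_bigr => -[c [x y]] _ /=.
  have kE x' : k x' = transform mu e (fun a => ((w a)%:C)%C * ((e x' a)^*)%C) by [].
  have kL x' := transform_kernel_wL2 w_gt0 w_int me e1 x'.
  have -> : square_tensor (c *: k x) (k y) = c *: square_tensor (k x) (k y).
    by apply/funext => p; rewrite /square_tensor !fctE -scalerAl.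
  congr (_ *: _); rewrite !kE square_tensor_transform; try exact: c2.
  apply/funext => p; congr cintegral; apply/funext => z.
  by rewrite /square_weight /square_char conjcM rmorphM /=; ring.
Qed.

End TensorSquare.

(** * The dual group and its Haar measure *)

Section DualTopology.
Context {R : realType} {G : topologicalZmodType}.
Local Notation dualG := (dual R G).

(** On continuous maps, compact-open convergence is uniform convergence on compact sets. This lemma
    and the next translate the dual topology into such estimates and back. *)
Lemma near_dual_compact (a : dualG) (K : set G) (r : R) : compact K -> 0 < r ->
  \forall b \near a, forall x, K x -> modc ((b : dualG) x - a x) < r.
Proof.
move=> cK r0.
have cE : {compact-open, (fun b : dualG => (b : G -> R[i]^o)) @ a --> (a : G -> R[i]^o)}.
  exact: (@initial_continuous _ _ (@dual_embedding R G) a).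
have FF : Filter ((fun b : dualG => (b : G -> R[i]^o)) @ a).
  exact: (fmap_filter _ (nbhs_filter (a : dualG))).
have cF := (compact_open_fam_compactP (@dual_continuous _ _ a) FF).1 cE.
have cU := (fam_cvgP _ _ FF).1 cF K cK.
have rC : 0 < r%:C%C :> R[i] by rewrite ltcR.
have : nbhs (a : {uniform` K -> R[i]^o})
    [set h | forall x, K x -> modc (h x - a x) < r].
  apply/uniform_nbhs.
  exists [set z : R[i]^o * R[i]^o | ball z.1 r%:C%C z.2]; split.
    by rewrite -entourage_ballE; exists r%:C%C.
  move=> h /= hK x Kx; have := hK x Kx.
  by rewrite /ball /= -normrN opprB -modcC ltcR.
by move=> /cU.
Qed.

Lemma cvg_dual_compact (F : set_system dualG) (a : dualG) : Filter F ->
  (forall (K : set G) (r : R), compact K -> 0 < r ->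
     \forall b \near F, forall x, K x -> modc ((b : dualG) x - a x) < r) ->
  {compact-open, (fun b : dualG => (b : G -> R[i]^o)) @ F --> (a : G -> R[i]^o)}.
Proof.
move=> FF h; apply/compact_open_fam_compactP; first exact: dual_continuous.
apply/fam_cvgP => K cK P /uniform_nbhs[E [entE EP]].
move: entE; rewrite -entourage_ballE => -[e /= e0 eE].
have eR : e = (complex.Re e)%:C%C.
  by move: e0; case: (e) => x y; rewrite ltcE /= => /andP[/eqP -> _].
have er0 : 0 < complex.Re e by move: e0; rewrite ltcE => /andP[].
apply: filterS (h K _ cK er0) => b hb; apply: EP => x Kx; apply: eE => /=.
by rewrite /ball /= eR -normrN opprB -modcC ltcR; exact: hb.
Qed.

Lemma dual_eval_continuous (x : G) : continuous (fun a : dualG => a x : R[i]^o).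
Proof.
move=> a; apply/(@cvgrPdist_lt _ _ _ _ (nbhs_filter (a : dualG))) => e e0.
have eR : e = (complex.Re e)%:C%C.
  by move: e0; case: (e) => p q; rewrite ltcE /= => /andP[/eqP -> _].
have er0 : 0 < complex.Re e by move: e0; rewrite ltcE => /andP[].
apply: filterS (near_dual_compact a (@compact_set1 _ x) er0) => b /(_ x erefl).
by move=> hb; rewrite eR -normrN opprB -modcC ltcR.
Qed.

Lemma dual_sub_continuous : continuous (fun p : dualG * dualG => p.1 - p.2).
Proof.
apply: (@continuous_comp_initial _ _ _ (@dual_embedding R G)) => -[a b].
have h := @cvg_dual_compact ((fun p : dualG * dualG => p.1 - p.2) @ (a, b)) (a - b) _.
apply: h => K r cK r0; have r2 : 0 < r / 2 by rewrite divr_gt0.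
(* [(a - b) x] is [a x * b (- x)], so [b] has to be controlled on the opposite of [K]. All factors
   have modulus 1, hence the two errors simply add. *)
have cNK : compact (-%R @` K).
  apply: continuous_compact => //.
  by apply: continuous_subspaceT => x; exact: opp_continuous.
have ha := near_dual_compact a cK r2; have hb := near_dual_compact b cNK r2.
exists ([set a' | forall x, K x -> modc ((a' : dualG) x - a x) < r / 2],
  [set b' | forall x, (-%R @` K) x -> modc ((b' : dualG) x - b x) < r / 2]) => //.
move=> [a' b'] [h1 h2] x Kx.
have h1x : modc (a' x - a x) < r / 2 := h1 x Kx.
have h2x : modc (b' (- x) - b (- x)) < r / 2.
  by apply: h2; exists x.
have -> : (a' - b' : dualG) x - (a - b : dualG) x =
    (a' x - a x) * b' (- x) + a x * (b' (- x) - b (- x)).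
  by rewrite /= mulrBl mulrBr addrA subrK.
have m1 (c : dualG) y : modc (c y) = 1 by rewrite dual_norm1.
apply: le_lt_trans (modcD _ _) _; rewrite !modcM !m1 mulr1 mul1r; lra.
Qed.

Lemma dual_modc (a : dualG) x : modc (a x) = 1.
Proof. by rewrite dual_norm1. Qed.

End DualTopology.

(** If [P K] failed, the sets [A] with [P] of [K] minus [A] would form a proper filter containing
    [K]. At a cluster point in [K], a neighborhood satisfying [P] has its complement in the filter,
    a contradiction. *)
Lemma compact_induction {T : topologicalType} (P : set T -> Prop) (K : set T) :
  P set0 -> (forall A B, P A -> P B -> P (A `|` B)) ->
  (forall A B, A `<=` B -> P B -> P A) ->
  (forall x, K x -> exists2 U, nbhs x U & P U) -> compact K -> P K.
Proof.
move=> P0 PU PS Ploc cK; apply: contrapT => NPK.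
pose F : set_system T := [set A | P (K `\` A)].
have FF : ProperFilter F.
  split; first by rewrite /F /= setD0.
  split.
  - by rewrite /F /= setDT.
  - by move=> A B PA PB; rewrite /F /= setDIr; exact: PU.
  - by move=> A B AB; apply: PS => x [Kx nBx]; split => // /AB.
have FK : F K by rewrite /F /= setDv.
have [x [Kx clx]] := cK F FF FK.
have [U nU PUx] := Ploc x Kx.
have FU : F (~` U) by rewrite /F /= setDE setCK; apply: PS PUx => y [].
by have [y []] := clx _ _ FU nU.
Qed.

Section ComplexContinuity.
Context {R : realType} {T : topologicalType}.
Variable f : T -> R[i].
Hypothesis cf : continuous (f : T -> R[i]^o).

Lemma near_modc_lt x (r : R) : 0 < r -> \forall y \near x, modc (f x - f y) < r.
Proof.
move=> r0; have rC : 0 < r%:C%C :> R[i] by rewrite ltcR.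
have /cvgrPdist_lt/(_ _ rC) := @cf x.
by apply: filterS => y; rewrite -modcC ltcR.
Qed.

Lemma continuous_Re : continuous (fun x => complex.Re (f x)).
Proof.
move=> x; apply/cvgrPdist_lt => r r0.
apply: filterS (near_modc_lt x r0) => y; apply: le_lt_trans.
by rewrite -ReB le_norm_Re.
Qed.

Lemma continuous_Im : continuous (fun x => complex.Im (f x)).
Proof.
move=> x; apply/cvgrPdist_lt => r r0.
apply: filterS (near_modc_lt x r0) => y; apply: le_lt_trans.
by rewrite -ImB le_norm_Im.
Qed.

End ComplexContinuity.

(** * Borel measurability of continuous maps *)

Section Borel.
Context {R : realType} {L : PreTopologicalZmodule.type}.
Local Notation B := (borel L).

Lemma borel_open (U : set L) : open U -> measurable (U : set B).
Proof. by move=> oU; exact: sub_sigma_algebra. Qed.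

Lemma borel_closed (U : set L) : closed U -> measurable (U : set B).
Proof.
move=> cU; rewrite -[U]setCK; apply: measurableC.
by apply: (borel_open (U := ~` U)); rewrite openC.
Qed.

Lemma borel_continuous (f : L -> R) : continuous f ->
  measurable_fun (setT : set B) (f : B -> R).
Proof.
move=> /continuousP cf; apply: (measurability _ (RGenOInfty.measurableE R)).
move=> _ [_ [x ->] <-]; rewrite setTI set_itvE.
by apply: (borel_open (U := f @^-1` _)); exact/cf/open_gt.
Qed.

Lemma borel_continuous_map (f : L -> L) : continuous f ->
  measurable_fun (setT : set B) (f : B -> B).
Proof.
move=> /continuousP cf; apply: (@measurability _ _ B B setT f (@open L)) => //.
move=> _ [U oU <-]; rewrite setTI.
by apply: (borel_open (U := f @^-1` U)); exact: cf.
Qed.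

Lemma borel_ccontinuous (f : L -> R[i]) : continuous (f : L -> R[i]^o) ->
  cmeasurable (f : B -> R[i]).
Proof.
by move=> cf; split; apply: borel_continuous;
  [exact: continuous_Re|exact: continuous_Im].
Qed.

End Borel.

(** * Topological groups: [subC] ties together the two structures that [L] carries *)

Section TopologicalGroup.
Context {L : PreTopologicalZmodule.type}.
Hypothesis subC : continuous (fun p : L * L => p.1 - p.2).

Lemma sub_continuous2 {T : topologicalType} (f g : T -> L) :
  continuous f -> continuous g -> continuous (fun x => f x - g x).
Proof.
move=> cf cg x; apply: (@continuous_comp _ _ _ (fun x => (f x, g x))
  (fun p : L * L => p.1 - p.2)); last exact: subC.
by apply: cvg_pair; [exact: cf|exact: cg].
Qed.

Lemma sub_cst_continuous (a : L) : continuous (fun x : L => x - a).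
Proof. by apply: sub_continuous2 => // x; [exact: cvg_id|exact: cvg_cst]. Qed.

Lemma cst_sub_continuous (a : L) : continuous (fun x : L => a - x).
Proof. by apply: sub_continuous2 => // x; [exact: cvg_cst|exact: cvg_id]. Qed.

End TopologicalGroup.

(** * Translation invariance *)

Section HaarMeasure.
Context {R : realType} {L : PreTopologicalZmodule.type}.
Local Notation B := (borel L).
Hypothesis subC : continuous (fun p : L * L => p.1 - p.2).
Variable mu : {measure set B -> \bar R}.
Hypothesis haar : is_haar mu.
Local Notation rint f := (mu.-integrable setT (fun y : B => (f y)%:E)).

Lemma measurable_translate (a : L) :
  measurable_fun (setT : set B) (fun x : B => (x : L) - a : B).
Proof.
apply: (@borel_continuous_map L (fun x : L => x - a)).
exact: sub_cst_continuous subC a.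
Qed.

Lemma haar_preimage (a : L) (A : set B) : measurable A ->
  mu ((fun x : B => (x : L) - a : B) @^-1` A) = mu A.
Proof.
move=> mA; rewrite -(haar_translation haar a mA); congr (mu _).
apply/seteqP; split => [x /= Ax|_ [y Ay <-]] /=.
  by exists ((x : L) - a) => //; rewrite addrC subrK.
by rewrite addrC addKr.
Qed.

Lemma ge0_haar_integral (f : B -> \bar R) (a : L) :
  measurable_fun setT f -> (forall x, 0 <= f x)%E ->
  (\int[mu]_x f ((x : L) - a)%R = \int[mu]_x f x)%E.
Proof.
move=> mf f0.
have := @ge0_integral_pushforward _ _ _ _ _ _ (measurable_translate a) mu setT f
  measurableT mf (fun x _ => f0 x).
move=> h; apply: etrans (esym h) _; apply: eq_measure_integral.
  exact: measurable_translate.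
by move=> mt A mA _; exact: haar_preimage.
Qed.

Lemma rint_translate (f : B -> R) (a : L) : rint f ->
  rint (fun x : B => f ((x : L) - a)).
Proof.
move=> fi; have mf := rint_measurable fi; have mt := measurable_translate a.
have mfa : measurable_fun setT (fun x : B => f ((x : L) - a)).
  exact: (measurableT_comp mf mt).
apply/integrableP; split; first exact/measurable_EFinP.
have -> : (\int[mu]_x `|(f ((x : L) - a))%:E| = \int[mu]_x `|(f x)%:E|)%E.
  by apply: (ge0_haar_integral (f := fun x => `|(f x)%:E|%E)) => //;
    apply: measurableT_comp => //; exact/measurable_EFinP.
by have /integrableP[] := fi.
Qed.

Lemma haar_Rintegral (f : B -> R) (a : L) : rint f ->
  \int[mu]_x f ((x : L) - a) = \int[mu]_x f x.
Proof.
move=> fi; have mt := measurable_translate a.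
have mf : measurable_fun setT (fun x : B => (f x)%:E).
  by have /integrableP[] := fi.
have := @integral_pushforward _ _ _ _ _ _ mt mu setT (fun x => (f x)%:E) mf.
move=> /(_ (rint_translate a fi) measurableT) h; congr fine.
apply: etrans (esym h) _; apply: eq_measure_integral => A mA _.
exact: haar_preimage.
Qed.

Lemma cintegrable_translate (f : B -> R[i]) (a : L) : cintegrable mu f ->
  cintegrable mu (fun x : B => f ((x : L) - a)).
Proof.
move=> [fr fi]; split.
  exact: (rint_translate (f := fun x => complex.Re (f x))).
exact: (rint_translate (f := fun x => complex.Im (f x))).
Qed.

Lemma haar_cintegral (f : B -> R[i]) (a : L) : cintegrable mu f ->
  cintegral mu (fun x : B => f ((x : L) - a)) = cintegral mu f.
Proof.
move=> [fr fi]; congr Complex.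
  exact: (haar_Rintegral (f := fun x => complex.Re (f x))).
exact: (haar_Rintegral (f := fun x => complex.Im (f x))).
Qed.

(** If [U] were null, its translates would cover each compact set by finitely many null sets, and
    countably many compact sets exhaust the group. *)
Lemma haar_open_neq0 (K : nat -> set L) (U : set L) :
  (forall n, compact (K n)) -> \bigcup_n K n = setT ->
  open U -> U !=set0 -> mu U <> 0%E.
Proof.
move=> cK KT oU [u Uu] U0; apply: (haar_neq0 haar); apply/negligibleP => //.
rewrite -KT; apply: negligible_bigcup => n.
apply: (compact_induction (P := fun A => mu.-negligible (A : set B))) (cK n).
- exact: negligible_set0.
- by move=> A A'; exact: negligibleU.
- by move=> A A' AA'; exact: negligibleS.
move=> x _; exists ((fun y : L => y - (x - u)) @^-1` U).
  apply: (sub_cst_continuous subC) => //.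
  by rewrite /= opprB addrCA subrr addr0; exact: open_nbhs_nbhs.
have mU := borel_open oU; apply/negligibleP; last first.
  exact: etrans (haar_preimage (x - u) mU) U0.
by rewrite -[X in measurable X]setTI; exact: measurable_translate.
Qed.

End HaarMeasure.

(** * The weight, its level sets, and joint measurability *)

Section Weight.
Context {R : realType} {L : PreTopologicalZmodule.type}.
Local Notation B := (borel L).
Hypothesis subC : continuous (fun p : L * L => p.1 - p.2).
Variable lambda : L -> R.
Hypothesis lambda_gt0 : forall a, 0 < lambda a.
Hypothesis lambda_C0 : C0 lambda.

Definition level (n : nat) : set L := [set a | n.+1%:R^-1 <= lambda a].

Lemma level_closed n : closed (level n).
Proof.
apply: (@closed_comp _ _ lambda [set x | n.+1%:R^-1 <= x]); last exact: closed_ge.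
by move=> a _; exact: lambda_C0.1.
Qed.

Lemma level_compact n : compact (level n).
Proof.
have n0 : 0 < n.+1%:R^-1 :> R by rewrite invr_gt0.
have [K [cK hK]] := lambda_C0.2 _ n0.
apply: (subclosed_compact (@level_closed n) cK) => a /= ha.
apply: contrapT => /hK; rewrite gtr0_norm // ltNge; exact/negP/negPn.
Qed.

Lemma level_nondecreasing : {homo level : n m / (n <= m)%N >-> (n <= m)%O}.
Proof.
move=> n m nm; apply/subsetPset => a; apply: le_trans.
by rewrite lef_pV2 ?posrE // ler_nat.
Qed.

Lemma level_in a : exists n, level n a.
Proof.
have [n _ hn] := @near_infty_natSinv_lt R (PosNum (lambda_gt0 a)).
by exists n; exact/ltW/(hn n)/leqnn.
Qed.

Lemma bigcup_level : \bigcup_n level n = setT.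
Proof.
by apply/seteqP; split => // a _; have [n ha] := level_in a; exists n.
Qed.

Lemma weight_bounded : exists M, forall a, lambda a <= M.
Proof.
have [K [cK hK]] := lambda_C0.2 _ ltr01.
have [M hM] : exists M, forall a, K a -> lambda a <= M.
  apply: (compact_induction (P := fun A => exists M, forall a, A a -> lambda a <= M))
    cK.
  - by exists 0.
  - move=> A A' [M hM] [M' hM']; exists (Num.max M M') => a [/hM h|/hM' h];
      by rewrite le_max h ?orbT.
  - by move=> A A' AA' [M hM]; exists M => a /AA'; exact: hM.
  move=> x _; exists (lambda @^-1` [set y | y < lambda x + 1]).
    apply: lambda_C0.1; apply: open_nbhs_nbhs; split; first exact: open_lt.
    by rewrite /= ltrDl.
  by exists (lambda x + 1) => a /ltW.
exists (Num.max M 1) => a; rewrite le_max; have [/hM ->//|nKa] := pselect (K a).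
have := hK a nKa; rewrite gtr0_norm // => /ltW ->; exact: orbT.
Qed.

(** Compactness gives the estimate for [a] in [K]. If only [a + v] lies in [K], the estimate is
    applied there with the shift [- v]. If neither does, both values lie between 0 and [r]. *)
Lemma weight_uniform_continuous (r : R) : 0 < r ->
  \forall v \near (0 : L), forall a, `|lambda (a + v) - lambda a| < r.
Proof.
move=> r0; have [K [cK hK]] := lambda_C0.2 _ r0.
have addC : continuous (fun p : L * L => p.1 + p.2).
  have -> : (fun p : L * L => p.1 + p.2) = (fun p : L * L => p.1 - (0 - p.2)).
    by apply/funext => p; rewrite sub0r opprK.
  apply: sub_continuous2 => //; first by move=> p; exact: cvg_fst.
  apply: sub_continuous2 => // p; [exact: cvg_cst|exact: cvg_snd].
have nearK : \forall v \near (0 : L), forall a, K a ->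
    `|lambda (a + v) - lambda a| < r.
  move/compact_near_coveringP : cK => /(_ _ (nbhs (0 : L))
    (fun v a => `|lambda (a + v) - lambda a| < r) _); apply => x _.
  have cF : {for (x, (0 : L)), continuous (fun p : L * L =>
      lambda (p.1 + p.2) - lambda p.1)}.
    apply: (@continuousB _ R^o).
      by apply: (continuous_comp (addC (x, 0))); exact: lambda_C0.1.
    by apply: (continuous_comp (@cvg_fst _ _ _ _ _)); exact: lambda_C0.1.
  have : (fun p : L * L => lambda (p.1 + p.2) - lambda p.1) @ (x, (0 : L)) -->
    lambda (x + 0) - lambda x := cF.
  by rewrite addr0 subrr => /cvgr0_norm_lt/(_ r r0).
have nearN : \forall v \near (0 : L), forall a, K a ->
    `|lambda (a + - v) - lambda a| < r.
  have : (fun v : L => 0 - v) @ (0 : L) --> (0 - 0 : L) :=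
    @cst_sub_continuous L subC 0 0.
  rewrite subr0 => /(_ _ nearK) h.
  have {}h : \forall v \near (0 : L), forall a, K a ->
    `|lambda (a + (0 - v)) - lambda a| < r := h.
  by apply: filterS h => v h a Ka; have := h a Ka; rewrite sub0r.
apply: filterS2 nearK nearN => v h1 h2 a.
have [/h1 //|nKa] := pselect (K a).
have [/h2|nKav] := pselect (K (a + v)); first by rewrite addrK distrC.
have := hK _ nKa; rewrite gtr0_norm // => h3.
have := hK _ nKav; rewrite gtr0_norm // => h4.
rewrite ltr_norml; have := lambda_gt0 a; have := lambda_gt0 (a + v); lra.
Qed.

(* Without second countability the product of the Borel sigma-algebras can be
   smaller than the Borel sigma-algebra of the product.  Here an open set is
   a countable union of compact sets, each of which lies in a finite union of
   open rectangles contained in that open set. *)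
Lemma product_measurable (F : L * L -> R) : continuous F ->
  measurable_fun (setT : set (B * B)) (F : B * B -> R).
Proof.
move=> cF; apply: (measurability _ (RGenOInfty.measurableE R)).
move=> _ [_ [r ->] <-]; rewrite setTI set_itvE.
have oF : open (F @^-1` [set y | r < y]).
  by move/continuousP : cF; apply; exact: open_gt.
(* The margin 1 / (n+1) replaces the open condition by a closed one, which makes [C n] compact. *)
pose C n := (level n `*` level n) `&` (F @^-1` [set y | r + n.+1%:R^-1 <= y]).
have cC n : compact (C n).
  apply: compact_closedI; first by apply: compact_setX; exact: level_compact.
  apply: closed_comp; last exact: closed_ge.
  by move=> z _; exact: cF.
have /choice[N hN] : forall n, exists N : set (B * B),
    [/\ measurable N, C n `<=` N & N `<=` F @^-1` [set y | r < y]].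
  move=> n; apply: (@compact_induction _ (fun A => exists N : set (B * B),
    [/\ measurable N, A `<=` N & N `<=` F @^-1` [set y | r < y]])) (cC n).
  - by exists set0; split.
  - move=> A A' [N [mN AN Nr]] [N' [mN' AN' Nr']]; exists (N `|` N'); split.
    + exact: measurableU.
    + exact: setUSS.
    + by move=> z [/Nr|/Nr'].
  - move=> A A' AA' [N [mN AN Nr]]; exists N; split => //.
    exact: subset_trans AN.
  move=> [x y] [_ /= Fr].
  have rF : r < F (x, y) by apply: lt_le_trans Fr; rewrite ltrDl invr_gt0.
  have : nbhs (x, y) (F @^-1` [set y | r < y]) by exact: open_nbhs_nbhs.
  move=> [[U V] /= [nU nV] UV]; exists (U^° `*` V^°).
    by exists (U^°, V^°) => //; split; exact: nbhs_interior.
  exists (U^° `*` V^°); split => //.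
    by apply: measurableX; apply: borel_open; exact: open_interior.
  by move=> z [/interior_subset Uz /interior_subset Vz]; exact: UV.
rewrite (_ : _ @^-1` _ = \bigcup_n N n).
  by apply: bigcup_measurable => n _; have [] := hN n.
apply/seteqP; split => [[x y] rF|z [n _]]; last by have [_ _] := hN n; apply.
have [n1 h1] := level_in x; have [n2 h2] := level_in y.
have d0 : 0 < F (x, y) - r by rewrite subr_gt0.
have [n3 _ h3] := @near_infty_natSinv_lt R (PosNum d0).
pose n := maxn n1 (maxn n2 n3).
have lv m z : (m <= n)%N -> level m z -> level n z.
  by move=> mn; have /subsetPset := level_nondecreasing mn; apply.
exists n => //; have [_ CN _] := hN n; apply: CN; split.
  split => /=.
    by apply: lv h1; rewrite leq_maxl.
  by apply: lv h2; rewrite /n (maxnCA n1) leq_maxl.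
have /= := h3 n; rewrite /n !leq_max leqnn !orbT => /(_ isT).
rewrite ltrBrDl; exact: ltW.
Qed.

End Weight.

(** * The self-convolution of the weight *)

Section Convolution.
Context {R : realType} {L : PreTopologicalZmodule.type}.
Local Notation B := (borel L).
Hypothesis subC : continuous (fun p : L * L => p.1 - p.2).
Variable mu : {sigma_finite_measure set B -> \bar R}.
Hypothesis haar : is_haar mu.
Local Notation rint f := (mu.-integrable setT (fun y : B => (f y)%:E)).
Variable lambda : L -> R.
Hypothesis lambda_gt0 : forall a, 0 < lambda a.
Hypothesis lambda_C0 : C0 lambda.
Hypothesis lambda_int : rint lambda.

Definition self_convolution (g : L) : R :=
  \int[mu]_a (lambda a * lambda (g - (a : L))).

Lemma self_convolution_integrand g :
  rint (fun a => lambda a * lambda (g - (a : L))).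
Proof.
have [M hM] := weight_bounded lambda_gt0 lambda_C0.
apply: rint_le (rintZ M lambda_int).
  apply: measurable_funM; first exact: rint_measurable lambda_int.
  apply: (borel_continuous (f := fun a => lambda (g - a))) => a.
  apply: (continuous_comp (@cst_sub_continuous L subC g a)).
  exact: lambda_C0.1.
move=> a; rewrite ger0_norm; last by rewrite mulr_ge0 // ltW.
by rewrite mulrC ler_pM2r.
Qed.

(** Tonelli: by invariance, the inner integral is [lambda x] times the total mass of [lambda]. Joint
    measurability comes from [product_measurable]. *)
Lemma self_convolution_prod :
  (mu \x mu)%E.-integrable setT
    (fun z : B * B => (lambda z.1 * lambda ((z.2 : L) - z.1))%:E).
Proof.
have F0 (x y : L) : 0 <= lambda x * lambda (y - x) by rewrite mulr_ge0 // ltW.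
apply/integrable12ltyP => /=.
  apply/measurable_EFinP.
  apply: (product_measurable lambda_gt0 lambda_C0
    (F := fun p : L * L => lambda p.1 * lambda (p.2 - p.1))).
  have cl := lambda_C0.1; move=> p; apply: (@cvgM _ (L * L)%type).
    by apply: (@continuous_comp _ _ _ (fun p : L * L => p.1) lambda p);
      [exact: cvg_fst|exact: cl].
  apply: (@continuous_comp _ _ _ (fun p : L * L => p.2 - p.1) lambda p);
    last exact: cl.
  apply: (sub_continuous2 subC (f := fun p : L * L => p.2)) => q;
    [exact: cvg_snd|exact: cvg_fst].
under eq_integral => x _.
  under eq_integral do rewrite ger0_norm // EFinM.
  rewrite ge0_integralZl_EFin //=; last 3 first.
  - by move=> y _; rewrite lee_fin ltW.
  - apply/measurable_EFinP; exact: rint_measurable (rint_translate subC haar _ lambda_int).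
  - exact: ltW.
  rewrite (ge0_haar_integral subC haar (f := fun y => (lambda y)%:E)) //; last 2 first.
  - exact/measurable_EFinP/rint_measurable/lambda_int.
  - by move=> y; rewrite lee_fin ltW.
  rewrite (rint_fin lambda_int) -EFinM mulrC.
  over.
exact: (integrable_lty measurableT (rintZ _ lambda_int)).
Qed.

Lemma self_convolution_integrable : rint self_convolution.
Proof. exact: (real_fubini (real_fubini_swap self_convolution_prod).1).1. Qed.

Lemma self_convolution_ge0 g : 0 <= self_convolution g.
Proof. by apply: Rintegral_ge0 => a _; rewrite mulr_ge0 // ltW. Qed.

(* Fubini, together with the substitution [g := g + a] in the inner integral *)
Lemma self_convolution_transform (chi : L -> R[i]) :
  continuous (chi : L -> R[i]^o) -> (forall a, modc (chi a) = 1) ->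
  (forall a b, chi (a + b) = chi a * chi b) ->
  cintegral mu (fun g => (self_convolution g)%:C%C * chi g) =
  cintegral mu (fun a => (lambda a)%:C%C * chi a) ^+ 2.
Proof.
move=> cchi chi1 chiD; have mchi := borel_ccontinuous cchi.
pose F (z : B * B) := (lambda z.1 * lambda ((z.2 : L) - z.1))%:C%C * chi z.2.
have rlC (f : B -> R) : rint f -> cintegrable mu (fun a => (f a)%:C%C).
  by move=> fi; split => //=; exact: integrable0.
have Fi : cintegrable (mu \x mu)%E F.
  apply: (cintegrable_bounded (M := 1)); last first.
  - split => /=; first exact: self_convolution_prod.
    exact: integrable0.
  - by move=> z; rewrite chi1.
  - exact: cmeasurable_snd.
have lchi : cintegrable mu (fun a => (lambda a)%:C%C * chi a).
  apply: (cintegrable_bounded (M := 1)); last exact: rlC.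
  - exact: mchi.
  - by move=> a; rewrite chi1.
have [Fs _] := complex_fubini_swap Fi.
transitivity (cintegral mu (fun g => cintegral mu (fun a => F (a, g)))).
  congr cintegral; apply/funext => g; rewrite /F /= /self_convolution.
  rewrite -cintegral_real mulrC -cintegralZ.
    by congr cintegral; apply/funext => a; exact: mulrC.
  exact/rlC/self_convolution_integrand.
rewrite (complex_fubini Fs).2 (complex_fubini_swap Fi).2 -(complex_fubini Fi).2.
rewrite expr2 -cintegralZ //; congr cintegral; apply/funext => a.
pose g b : R[i] := (lambda b)%:C%C * chi b.
transitivity (cintegral mu (fun b : B => ((lambda a)%:C%C * chi a) * g ((b : L) - a))).
  congr cintegral; apply/funext => b; rewrite /F /g /= rmorphM /=.
  have -> : chi b = chi a * chi ((b : L) - a) by rewrite -chiD addrC subrK.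
  by ring.
rewrite cintegralZ; last exact: (cintegrable_translate subC haar _ lchi).
by rewrite (haar_cintegral subC haar _ lchi) mulrC.
Qed.

(** Uniform continuity of [lambda] acts under the integral sign: for [g] near [g0] the difference is
    at most r / (W + 1) times the mass [W] of [lambda]. *)
Lemma self_convolution_continuous : continuous self_convolution.
Proof.
move=> g0; apply/cvgrPdist_lt => r r0; pose W := \int[mu]_a lambda a.
have W0 : 0 <= W by apply: Rintegral_ge0 => a _; exact: ltW.
have rW : 0 < r / (W + 1) by rewrite divr_gt0 // ltr_wpDl.
have nr := weight_uniform_continuous subC lambda_gt0 lambda_C0 rW.
have h : (fun g : L => g - g0) @ g0 --> (g0 - g0 : L) :=
  @sub_cst_continuous L subC g0 g0.
rewrite subrr in h; have {}h : \forall g \near g0, forall a,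
  `|lambda (a + (g - g0)) - lambda a| < r / (W + 1) := h _ nr.
apply: filterS h => g hg; rewrite /self_convolution.
have i0 := self_convolution_integrand g0; have i1 := self_convolution_integrand g.
rewrite -RintegralB //; apply: le_lt_trans (le_normr_Rintegral _ _) _ => //.
  exact: rintB.
apply: (@le_lt_trans _ _ (\int[mu]_a (r / (W + 1) * lambda a))).
  apply: le_Rintegral => //; [exact/rint_norm/rintB|exact: rintZ|].
  move=> a _; rewrite -mulrBr normrM (gtr0_norm (lambda_gt0 a)) mulrC ler_pM2r //.
  rewrite distrC; have := hg (g0 - (a : L)).
  have -> : g0 - (a : L) + (g - g0) = g - (a : L) by rewrite addrC addrA subrK.
  exact: ltW.
rewrite RintegralZl // -/W mulrAC ltr_pdivrMr ?ltr_wpDl //.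
by rewrite mulrDr mulr1 ltrDl.
Qed.

End Convolution.

(** * Trigonometric polynomials *)

Lemma bernoulli_ge (R : realType) (y : R) N : -1 <= y ->
  1 + y *+ N <= (1 + y) ^+ N.
Proof.
move=> y1; elim: N => [|N IH]; first by rewrite mulr0n addr0 expr0.
rewrite exprS mulrS; apply: le_trans (ler_wpM2l _ IH); last by lra.
rewrite -mulr_natr; have := sqr_ge0 y; have : 0 <= N%:R :> R by [].
nra.
Qed.

(* [k] is chosen with [2 < k d <= 3], so that [k x] is at most [1 / 2] when
   [x <= d / 6] and at least [2] when [d <= x]. *)
Lemma threshold_power (R : realType) (d r : R) : 0 < d <= 1 -> 0 < r ->
  exists n N : nat, forall x, 0 <= x <= 1 ->
    (x <= d / 6 -> 1 - r <= (1 - x ^+ n) ^+ N) /\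
    (d <= x -> (1 - x ^+ n) ^+ N <= r).
Proof.
move=> /andP[d0 d1] r0.
have [n hn] : exists n, 2^-1 ^+ n < r :> R.
  have z1 : `|2^-1 : R| < 1 by rewrite gtr0_norm ?invf_lt1 ?ltr1n.
  have /cvgr0_norm_lt/(_ r r0)[n _ h] := cvg_expr z1.
  by exists n; apply: le_lt_trans (ler_norm _) (h n (leqnn n)).
have [k [k2 k3]] : exists k : nat, 2 < k%:R * d /\ k%:R * d <= 3.
  have d20 : 0 <= 2 / d by rewrite divr_ge0 // ltW.
  exists (Num.truncn (2 / d)).+1; have /andP[h1 h2] := truncn_itv d20.
  split; first by rewrite -ltr_pdivrMr.
  rewrite -natr1 mulrDl mul1r.
  by have := h1; rewrite ler_pdivlMr //; lra.
(* With N = k^n, Bernoulli gives (1 - x^n)^N >= 1 - (k x)^n for small [x]. For large [x], (1 -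
   x^n)^N is at most the inverse of (1 + x^n)^N, which Bernoulli bounds below by (k x)^n >= 2^n. *)
exists n, (k ^ n)%N => x /andP[x0 x1].
have xn0 : 0 <= x ^+ n by exact: exprn_ge0.
have xn1 : x ^+ n <= 1 by exact: exprn_ile1.
have kx : x ^+ n *+ (k ^ n) = (k%:R * x) ^+ n.
  by rewrite -mulr_natl natrX exprMn.
split=> hx.
  have yN1 : -1 <= - x ^+ n by lra.
  have := bernoulli_ge (k ^ n) yN1; apply: le_trans.
  rewrite mulNrn kx lerD2l lerN2; apply: le_trans (ltW hn).
  apply: lerXn2r; rewrite ?nnegrE ?mulr_ge0 //.
  have : k%:R * x <= k%:R * (d / 6) by exact: ler_wpM2l.
  lra.
have y1 : -1 <= x ^+ n by lra.
have h2 : 2 ^+ n <= (1 + x ^+ n) ^+ (k ^ n).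
  apply: le_trans (bernoulli_ge _ y1); rewrite kx.
  apply: le_trans (_ : (k%:R * x) ^+ n <= _); last by rewrite lerDr.
  apply: lerXn2r; rewrite ?nnegrE ?mulr_ge0 //.
  have : k%:R * d <= k%:R * x by exact: ler_wpM2l.
  lra.
have p2 : 0 < 2 ^+ n :> R by exact: exprn_gt0.
have le1 : (1 - x ^+ n) ^+ (k ^ n) * (1 + x ^+ n) ^+ (k ^ n) <= 1.
  rewrite -exprMn; apply: exprn_ile1; nra.
apply: le_trans (ltW hn); rewrite exprVn -[leRHS]mul1r ler_pdivlMr //.
apply: le_trans le1; apply: ler_wpM2l => //.
by apply: exprn_ge0; rewrite subr_ge0.
Qed.

Section TrigonometricPolynomials.
Context {R : realType} {X : zmodType} {L : topologicalType}.
Variable e : X -> L -> R[i].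
Hypothesis eD : forall x y a, e (x + y) a = e x a * e y a.
Hypothesis e1 : forall x a, modc (e x a) = 1.

Definition trig_poly (s : seq (R[i] * X)) (a : L) : R[i] :=
  \sum_(p <- s) p.1 * e p.2 a.

Definition is_trig (f : L -> R[i]) := exists s, forall a, f a = trig_poly s a.

Definition real_trig (q : L -> R) := is_trig (fun a => (q a)%:C%C).

Lemma char_neq0 x a : e x a != 0.
Proof. by apply/eqP => h; have := e1 x a; rewrite h modc0 => /eqP; rewrite eq_sym oner_eq0. Qed.

Lemma char0 a : e 0 a = 1.
Proof. by apply: (mulfI (char_neq0 0 a)); rewrite -eD addr0 mulr1. Qed.

Lemma charN x a : e (- x) a = ((e x a)^*)%C.
Proof.
apply: (mulfI (char_neq0 x a)).
by rewrite -eD subrr char0 mulcJE e1 expr1n.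
Qed.

Lemma is_trigD f g : is_trig f -> is_trig g -> is_trig (fun a => f a + g a).
Proof.
move=> [s sf] [t tg]; exists (s ++ t) => a.
by rewrite sf tg /trig_poly big_cat.
Qed.

Lemma is_trigM f g : is_trig f -> is_trig g -> is_trig (fun a => f a * g a).
Proof.
move=> [s sf] [t tg]; exists [seq (p.1 * q.1, p.2 + q.2) | p <- s, q <- t] => a.
rewrite sf tg /trig_poly big_allpairs_dep /= mulr_suml; apply: eq_bigr => p _.
by rewrite mulr_sumr; apply: eq_bigr => q _; rewrite /= eD mulrACA.
Qed.

Lemma is_trig_cst c : is_trig (fun=> c).
Proof. by exists [:: (c, 0)] => a; rewrite /trig_poly big_seq1 char0 mulr1. Qed.

Lemma is_trig_char x : is_trig (e x).
Proof. by exists [:: (1, x)] => a; rewrite /trig_poly big_seq1 mul1r. Qed.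

Lemma eq_is_trig f g : f =1 g -> is_trig f -> is_trig g.
Proof. by move=> fg [s sf]; exists s => a; rewrite -fg. Qed.

Lemma real_trig_cst (c : R) : real_trig (fun=> c).
Proof. exact: is_trig_cst. Qed.

Lemma real_trigD p q : real_trig p -> real_trig q ->
  real_trig (fun a => p a + q a).
Proof.
by move=> hp hq; apply: eq_is_trig (is_trigD hp hq) => a; rewrite -rmorphD.
Qed.

Lemma real_trigM p q : real_trig p -> real_trig q ->
  real_trig (fun a => p a * q a).
Proof.
by move=> hp hq; apply: eq_is_trig (is_trigM hp hq) => a; rewrite -rmorphM.
Qed.

Lemma real_trig_compl p : real_trig p -> real_trig (fun a => 1 - p a).
Proof.
move=> hp; apply: eq_is_trig (real_trigD (real_trig_cst 1)
  (real_trigM (real_trig_cst (-1)) hp)) => a.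
by rewrite mulN1r.
Qed.

Lemma real_trigX p n : real_trig p -> real_trig (fun a => p a ^+ n).
Proof.
move=> hp; elim: n => [|n IH]; first exact: real_trig_cst.
by apply: eq_is_trig (real_trigM hp IH) => a; rewrite exprS.
Qed.

(** The squared modulus is the product of e_x - z and e_(-x) - conj z. The factor 1/4 keeps the
    values within [0, 1] when |z| = 1. *)
Lemma real_trig_dist x z : real_trig (fun a => modc (e x a - z) ^+ 2 / 4).
Proof.
have h1 := is_trigD (is_trig_char x) (is_trig_cst (- z)).
have h2 := is_trigD (is_trig_char (- x)) (is_trig_cst (- (z^*)%C)).
apply: eq_is_trig (is_trigM (is_trigM h1 h2) (is_trig_cst (4^-1)%:C%C)) => a.
by rewrite charN -conjcN -conjcD mulcJE -rmorphM.
Qed.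

Hypothesis e_cont : forall x, continuous (e x : L -> R[i]^o).

Lemma trig_poly_continuous s : continuous (trig_poly s : L -> R[i]^o).
Proof.
elim: s => [|p s IH] a; rewrite /trig_poly.
  by under eq_fun do rewrite big_nil; exact: cvg_cst.
under eq_fun do rewrite big_cons.
apply: (@cvgD _ R[i]^o); last exact: IH.
by apply: (@cvgM R[i]); [exact: cvg_cst|exact: e_cont].
Qed.

Lemma real_trig_continuous q : real_trig q -> continuous q.
Proof.
move=> [s sq]; have -> : q = (fun a => complex.Re (trig_poly s a)).
  by apply/funext => a; rewrite -sq.
exact: (continuous_Re (@trig_poly_continuous s)).
Qed.

Hypothesis e_sep : forall a b, (forall x, e x a = e x b) -> a = b.

(** Near a point [b] of [K], a character that distinguishes [a] from [b] provides the squared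
    distance to its value at [a]. Averaging handles unions and costs a factor 2 in [d]. *)
Lemma real_trig_vanish a (K : set L) : compact K -> ~ K a ->
  exists p d, [/\ real_trig p, forall b, 0 <= p b <= 1, p a = 0,
    0 < d <= 1 & forall b, K b -> d <= p b].
Proof.
move=> cK nKa; apply: (compact_induction (P := fun A => exists p d,
  [/\ real_trig p, forall b, 0 <= p b <= 1, p a = 0, 0 < d <= 1 &
      forall b, A b -> d <= p b])) cK.
- exists (fun=> 0), 1; split => //; first exact: real_trig_cst.
    by move=> _; rewrite lexx ler01.
  by rewrite ltr01 lexx.
- move=> A A' [p [d [hp p01 pa /andP[d0 d1] pd]]].
  move=> [q [c [hq q01 qa /andP[c0 c1] qc]]].
  have m0 : 0 < Num.min d c by rewrite lt_min d0.
  have m1 : Num.min d c <= d by rewrite ge_min lexx.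
  have m2 : Num.min d c <= c by rewrite ge_min lexx orbT.
  exists (fun b => 2^-1 * (p b + q b)), (Num.min d c / 2); split.
  + exact/(real_trigM (real_trig_cst _))/real_trigD.
  + by move=> b; have := p01 b; have := q01 b; lra.
  + by rewrite pa qa addr0 mulr0.
  + lra.
  + by move=> b [/pd|/qc] h; have := p01 b; have := q01 b; lra.
- move=> A A' AA' [p [d [hp p01 pa d01 pd]]].
  by exists p, d; split => // b /AA'; exact: pd.
move=> b Kb; have [x exab] : exists x, e x a <> e x b.
  apply: contrapT => h; apply: nKa; suff -> : a = b by [].
  by apply: e_sep => x; apply: contrapT => exab; apply: h; exists x.
pose p c := modc (e x c - e x a) ^+ 2 / 4.
have hp : real_trig p by exact: real_trig_dist.
have p01 c : 0 <= p c <= 1.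
  apply/andP; split; first by rewrite divr_ge0 ?sqr_ge0.
  have := modcD (e x c) (- e x a); rewrite modcN !e1 /p => h.
  have := modc_ge0 (e x c - e x a); rewrite ler_pdivrMr // mul1r; nra.
have pb0 : 0 < p b.
  rewrite divr_gt0 // exprn_even_gt0 //=; apply/eqP => /modc_eq0/eqP.
  by rewrite subr_eq0 => /eqP h; exact: exab.
exists (p @^-1` [set r | p b / 2 < r]).
  apply: (real_trig_continuous hp); apply: open_nbhs_nbhs.
  by split; [exact: open_gt|rewrite /=; lra].
exists p, (p b / 2); split => //.
- by rewrite /p subrr modc0 expr0n mul0r.
- by have := p01 b; lra.
- by move=> c /ltW.
Qed.

(* Brosowski and Deutsch's argument for the Stone-Weierstrass theorem, which
   avoids uniform approximation of the square root *)
Lemma real_trig_separation (C K : set L) (r : R) :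
  compact C -> compact K -> C `&` K = set0 -> 0 < r ->
  exists q, [/\ real_trig q, forall b, 0 <= q b <= 1,
    forall b, C b -> 1 - r <= q b & forall b, K b -> q b <= r].
Proof.
move=> cC cK CK0 r0; move: r r0.
apply: (compact_induction (P := fun A => forall r, 0 < r ->
  exists q, [/\ real_trig q, forall b, 0 <= q b <= 1,
    forall b, A b -> 1 - r <= q b & forall b, K b -> q b <= r])) cC.
- move=> r r0; exists (fun=> 0); split => //; first exact: real_trig_cst.
    by move=> _; rewrite lexx ler01.
  by move=> _ _; exact: ltW.
- move=> A A' IA IA' r r0; have r2 : 0 < r / 2 by rewrite divr_gt0.
  have [p [hp p01 pA pK]] := IA _ r2; have [q [hq q01 qA qK]] := IA' _ r2.
  (* This is close to 1 wherever one of [p], [q] is, and at most p + q on [K]. *)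
  exists (fun b => 1 - (1 - p b) * (1 - q b)); split.
  + by apply: real_trig_compl; apply: real_trigM; exact: real_trig_compl.
  + by move=> b; have := p01 b; have := q01 b; nra.
  + move=> b [/pA|/qA] h; have := p01 b; have := q01 b; nra.
  + move=> b Kb; have := pK b Kb; have := qK b Kb.
    have := p01 b; have := q01 b; nra.
- move=> A A' AA' IA' r r0; have [q [hq q01 qA qK]] := IA' r r0.
  by exists q; split => // b /AA'; exact: qA.
move=> a Ca; have nKa : ~ K a.
  by move=> Ka; have : (C `&` K) a by []; rewrite CK0.
have [p [d [hp p01 pa d01 pd]]] := real_trig_vanish cK nKa.
have /andP[d0 _] := d01.
exists (p @^-1` [set y | y < d / 6]).
  apply: (real_trig_continuous hp); apply: open_nbhs_nbhs.
  by split; [exact: open_lt|rewrite /= pa divr_gt0].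
move=> r r0; have [n [N hN]] := threshold_power d01 r0.
exists (fun b => (1 - p b ^+ n) ^+ N); split.
- exact/real_trigX/real_trig_compl/real_trigX.
- move=> b; have /andP[p0 p1] := p01 b.
  have := exprn_ge0 n p0; have := exprn_ile1 n p0 p1 => h1 h0.
  by rewrite exprn_ge0 ?subr_ge0 // exprn_ile1 ?subr_ge0 // gerBl.
- by move=> b /ltW hb; exact: (hN _ (p01 b)).1.
- by move=> b Kb; exact: (hN _ (p01 b)).2 (pd _ Kb).
Qed.

End TrigonometricPolynomials.

(** * Inner regularity with respect to an integrable density *)

Section Regularity.
Context {R : realType} {L : PreTopologicalZmodule.type}.
Local Notation B := (borel L).
Variable mu : {measure set B -> \bar R}.
Hypothesis haar : is_haar mu.
Local Notation rint f := (mu.-integrable setT (fun y : B => (f y)%:E)).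
Variable K : nat -> set L.
Hypothesis K_closed : forall n, closed (K n).
Hypothesis K_compact : forall n, compact (K n).
Hypothesis K_mono : {homo K : n m / (n <= m)%N >-> (n <= m)%O}.
Hypothesis K_cover : \bigcup_n K n = setT.

Variable h : B -> R.
Hypothesis h_ge0 : forall x, 0 <= h x.
Hypothesis h_int : rint h.

Lemma rint_indic (A : set B) (f : B -> R) : rint f -> measurable A ->
  rint (fun x => f x * \1_A x).
Proof.
move=> fi mA; apply: rint_le (rint_norm fi).
  by apply: measurable_funM; [exact: rint_measurable fi|exact: measurable_indic].
move=> x; rewrite normrM indicE; case: (_ \in _); rewrite ?normr1 ?normr0 ?mulr1 //.
by rewrite mulr0.
Qed.

Lemma Rintegral_indic (A : set B) (f : B -> R) :
  \int[mu]_(x in A) f x = \int[mu]_x (f x * \1_A x).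
Proof.
rewrite Rintegral_mkcond; apply: eq_Rintegral => x _.
by rewrite /patch indicE; case: (_ \in _); rewrite ?mulr1 ?mulr0.
Qed.

Lemma Rintegral_level_cvg (r : R) : 0 < r ->
  exists n, \int[mu]_x (h x * \1_(~` K n) x) < r.
Proof.
move=> r0; have mK n : measurable (K n : set B) by exact: borel_closed.
have := @ge0_nondecreasing_set_cvg_integral _ _ _ (K : nat -> set B)
  (fun x => (h x)%:E) mu K_mono mK.
have mh : measurable_fun setT (fun x : B => (h x)%:E).
  exact/measurable_EFinP/rint_measurable/h_int.
move=> /(_ (fun n => measurable_funTS mh)) /(_ (fun n x _ => h_ge0 x : (0 <= (h x)%:E)%E)).
rewrite K_cover (rint_fin h_int) => /fine_cvg /cvgrPdist_lt/(_ _ r0)[n _ hn].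
exists n; have /= := hn n (leqnn n); apply: le_lt_trans.
apply: le_trans (ler_norm _); rewrite -/(Rintegral _ _ _) (Rintegral_indic (K n : set B) h).
have iK := rint_indic h_int (mK n).
rewrite -RintegralB //; apply: le_Rintegral => //.
- exact/rint_indic/measurableC.
- exact: rintB.
- move=> x _; rewrite !indicE in_setC; case: (_ \in _) => /=; lra.
Qed.

(** Outer regularity of [K n] minus [A], a set of finite measure, gives an open [U] around it;
    removing [U] from [K n] leaves a closed compact part of [A]. What is lost lies outside [K n] or
    in [U] minus [D]: the former carries little of [h] by exhaustion, the latter by absolute
    continuity of the integral. *)
Lemma haar_inner_regular (A : set B) (r : R) : measurable A -> 0 < r ->
  exists C : set L, [/\ closed C, compact C, C `<=` A &
    \int[mu]_x (h x * \1_(A `\` C) x) < r].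
Proof.
move=> mA r0; have r2 : 0 < r / 2 by rewrite divr_gt0.
have [n hn] := Rintegral_level_cvg r2.
have mK : measurable (K n : set B) by exact: borel_closed.
have [d [d0 hd]] := integral_normr_continuous h_int r2.
pose D : set B := K n `\` A.
have mD : measurable D by exact: measurableD.
have Dfin : (mu D < +oo)%E.
  apply: (@le_lt_trans _ _ (mu (K n : set B))); last exact: haar_compact.
  by apply: le_measure; rewrite ?inE //; exact: subDsetl.
have outer := haar_outer haar mD.
have infin : ereal_inf [set mu U | U in [set U : set L | open U /\ D `<=` U]]
    \is a fin_num by rewrite -outer ge0_fin_numE.
have [_ [U [oU DU] <-]] := lb_ereal_inf_adherent d0 infin.
rewrite -outer => muU.
have mU : measurable (U : set B) by exact: borel_open.
have mUD : measurable (U `\` D : set B) by exact: measurableD.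
have UD : (mu (U `\` D) < d%:E)%E.
  have muE : (mu U = mu D + mu (U `\` D))%E.
    by rewrite -measureU ?setDIK // setDUK.
  by move: muU; rewrite [X in (X < _)%E]muE lteD2lE // ge0_fin_numE.
exists (K n `\` U); split.
- by apply: closedI => //; rewrite closedC.
- by apply: compact_closedI => //; rewrite closedC.
- by move=> x [Kx nUx]; apply: contrapT => nAx; apply: nUx; exact: DU.
have mC : measurable (K n `\` U : set B) by exact: measurableD.
apply: (@le_lt_trans _ _ (\int[mu]_x (h x * \1_(~` K n) x + h x * \1_(U `\` D) x))).
  apply: le_Rintegral => //.
  - exact/rint_indic/measurableD.
  - by apply: rintD; apply: rint_indic => //; exact: measurableC.
  - move=> x _; rewrite -mulrDr ler_wpM2l // !indicE.
    have [xAC|] := boolP (x \in A `\` (K n `\` U)); last by rewrite addr_ge0.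
    have [//|xK] := boolP (x \in ~` K n); first by rewrite lerDl.
    have -> : x \in U `\` D.
      rewrite inE; move: xAC xK; rewrite inE notin_setE => -[Ax nC] /contrapT Kx.
      split; first by apply: contrapT => nUx; exact: nC.
      by move=> [_ /(_ Ax)].
    by rewrite lerDr.
rewrite RintegralD //; [|exact/rint_indic/measurableC|exact: rint_indic].
have := hd _ mUD UD; rewrite Rintegral_indic.
rewrite (@eq_Rintegral _ _ _ mu setT (fun x => h x * \1_(U `\` D) x)); last first.
  by move=> x _; rewrite ger0_norm.
lra.
Qed.

End Regularity.

(** * Trigonometric approximation of indicators and injectivity of the transform *)

Section Approximation.
Context {R : realType} {L : PreTopologicalZmodule.type} {X : zmodType}.
Local Notation B := (borel L).
Variable mu : {measure set B -> \bar R}.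
Hypothesis haar : is_haar mu.
Local Notation rint f := (mu.-integrable setT (fun y : B => (f y)%:E)).
Variable K : nat -> set L.
Hypothesis K_closed : forall n, closed (K n).
Hypothesis K_compact : forall n, compact (K n).
Hypothesis K_mono : {homo K : n m / (n <= m)%N >-> (n <= m)%O}.
Hypothesis K_cover : \bigcup_n K n = setT.
Variable e : X -> L -> R[i].
Hypothesis eD : forall x y a, e (x + y) a = e x a * e y a.
Hypothesis e1 : forall x a, modc (e x a) = 1.
Hypothesis e_cont : forall x, continuous (e x : L -> R[i]^o).
Hypothesis e_sep : forall a b, (forall x, e x a = e x b) -> a = b.

Lemma real_trig_measurable q : real_trig e q ->
  measurable_fun (setT : set B) (q : B -> R).
Proof. by move=> hq; apply: borel_continuous => a; exact: real_trig_continuous. Qed.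

Lemma rint_mul_bounded (f q : B -> R) : rint f -> measurable_fun setT q ->
  (forall x, `|q x| <= 1) -> rint (fun x => f x * q x).
Proof.
move=> fi mq q1; apply: rint_le (rint_norm fi).
  by apply: measurable_funM => //; exact: rint_measurable fi.
by move=> x; rewrite normrM ler_piMr.
Qed.

(** [q] separates a compact part [C] of [A] from a compact part [D] of its complement. The error is
    at most r / 3 / (W + 1) on [C] and [D], and at most 1 on the two remainders, each of which
    carries less than r / 3 of |g|. *)
Lemma real_trig_approx_indic (g : B -> R) (A : set B) (r : R) :
  rint g -> measurable A -> 0 < r -> exists q : L -> R,
  [/\ real_trig e q, forall b, 0 <= q b <= 1 &
      \int[mu]_x (`|g x| * `|q x - \1_A x|) <= r].
Proof.
move=> gi mA r0; have hi := rint_norm gi; have h0 x : 0 <= `|g x| by [].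
have r3 : 0 < r / 3 by rewrite divr_gt0.
have mCA : measurable (~` A) by exact: measurableC.
have [C [clC cC CA hC]] := haar_inner_regular haar K_closed K_compact K_mono
  K_cover h0 hi mA r3.
have [D [clD cD DA hD]] := haar_inner_regular haar K_closed K_compact K_mono
  K_cover h0 hi mCA r3.
have CD0 : C `&` D = set0.
  by apply/seteqP; split => // x [/CA Ax /DA].
pose W := \int[mu]_x `|g x|.
have W0 : 0 <= W by exact: Rintegral_ge0.
have d0 : 0 < r / 3 / (W + 1) by rewrite divr_gt0 // ltr_wpDl.
have [q [hq q01 qC qD]] := real_trig_separation eD e1 e_cont e_sep cC cD CD0 d0.
exists q; split => //.
have mC : measurable (C : set B) by exact: borel_closed.
have mD : measurable (D : set B) by exact: borel_closed.
have mq := real_trig_measurable hq.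
have i1 : rint (fun x => `|g x| * \1_(A `\` C) x).
  by apply: rint_indic => //; exact: measurableD.
have i2 : rint (fun x => `|g x| * \1_(~` A `\` D) x).
  by apply: rint_indic => //; exact: measurableD.
apply: (@le_trans _ _ (\int[mu]_x (r / 3 / (W + 1) * `|g x| +
    (`|g x| * \1_(A `\` C) x + `|g x| * \1_(~` A `\` D) x)))).
  apply: le_Rintegral => //.
  - apply: rint_mul_bounded => //.
      by apply: measurableT_comp => //; exact: measurable_funB.
    move=> x; rewrite normr_id indicE ler_norml; have := q01 x.
    by case: (_ \in _) => /=; lra.
  - by apply: rintD; [exact: rintZ|exact: rintD].
  - move=> x _; rewrite [r / 3 / _ * _]mulrC -!mulrDr ler_wpM2l // !indicE.
    have := q01 x; have [xA|xA] := boolP (x \in A).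
      have [xC|xC] := boolP (x \in A `\` C).
        by rewrite ler_norml /=; case: (_ \in _) => /=; lra.
      have Cx : C x.
        apply: contrapT => nCx; move/negP : xC; apply.
        by rewrite inE; split => //; move: xA; rewrite inE.
      by have := qC x Cx; rewrite ler_norml /=; case: (_ \in _) => /=; lra.
    have [xD|xD] := boolP (x \in ~` A `\` D).
      by rewrite ler_norml /=; case: (_ \in _) => /=; lra.
    have Dx : D x.
      apply: contrapT => nDx; move/negP : xD; apply.
      by rewrite inE; split => //; move: xA; rewrite notin_setE.
    by have := qD x Dx; rewrite ler_norml /=; case: (_ \in _) => /=; lra.
rewrite RintegralD //; [|exact: rintZ|exact: rintD].
rewrite RintegralZl // RintegralD // -/W.
have : r / 3 / (W + 1) * W <= r / 3.
  by rewrite mulrAC ler_pdivrMr ?ltr_wpDl // ler_pM2l // lerDl.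
lra.
Qed.

Lemma real_trig_annihilator (g : B -> R) : rint g ->
  (forall q, real_trig e q -> (forall b, 0 <= q b <= 1) ->
     \int[mu]_x (g x * q x) = 0) ->
  {ae mu, forall x, g x = 0}.
Proof.
move=> gi g0; have key A : measurable A -> \int[mu]_x (g x * \1_A x) = 0.
  move=> mA; apply/eqP; rewrite -normr_le0; apply/ler_addgt0Pr => r r0.
  have [q [hq q01 qr]] := real_trig_approx_indic gi mA r0.
  have gq := g0 q hq q01; rewrite add0r; apply: le_trans qr.
  have iA := rint_indic gi mA.
  have iq : rint (fun x => g x * q x).
    apply: rint_mul_bounded => //; first exact: real_trig_measurable.
    by move=> x; have /andP[h1 h2] := q01 x; rewrite ger0_norm.
  rewrite -[X in `|X|]subr0 -gq -RintegralB //.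
  apply: le_trans (le_normr_Rintegral _ _) _ => //; first exact: rintB.
  rewrite le_eqVlt; apply/orP; left; apply/eqP; apply: eq_Rintegral => x _.
  by rewrite -mulrBr normrM distrC.
have : ae_eq mu setT (fun x => (g x)%:E) (cst 0%E).
  apply: integral_ae_eq => //= E _ mE; rewrite integral0.
  have fE : (\int[mu]_(x in E) (g x)%:E)%E \is a fin_num.
    by apply: integrable_fin_num => //; exact: integrableS gi.
  by rewrite -(fineK fE) -/(Rintegral _ _ _) Rintegral_indic key.
by apply: filterS => x /(_ I) [].
Qed.

Lemma cintegral_trig (f : B -> R[i]) s : cintegrable mu f ->
  cintegrable mu (fun a => f a * trig_poly e s a) /\
  cintegral mu (fun a => f a * trig_poly e s a) =
  \sum_(p <- s) p.1 * cintegral mu (fun a => f a * e p.2 a).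
Proof.
move=> fi; have fe x : cintegrable mu (fun a => f a * e x a).
  apply: (cintegrable_bounded (M := 1)) => //; first exact: borel_ccontinuous.
  by move=> a; rewrite e1.
elim: s => [|p s [IH1 IH2]].
  rewrite big_nil /trig_poly; under eq_fun do rewrite big_nil mulr0.
  by split; [split; exact: integrable0|exact: cintegral0].
have E : (fun a => f a * trig_poly e (p :: s) a) =
    (fun a => p.1 * (f a * e p.2 a) + f a * trig_poly e s a).
  by apply/funext => a; rewrite /trig_poly big_cons mulrDr mulrCA.
rewrite E big_cons; split; first by apply: cintegrableD => //; exact: cintegrableZ.
by rewrite cintegralD ?cintegralZ ?IH2 //; exact: cintegrableZ.
Qed.

Lemma char_transform_inj (f : B -> R[i]) : cintegrable mu f ->
  (forall x, transform mu (e : X -> B -> R[i]) f x = 0) ->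
  {ae mu, forall a, f a = 0}.
Proof.
(* Since [q] is real-valued, this identity splits into one for the real part and one for the
   imaginary part of [f]. *)
move=> fi f0; have fq q : real_trig e q ->
    cintegral mu (fun a => f a * (q a)%:C%C) = 0.
  move=> [s sq]; under eq_fun do rewrite sq.
  by rewrite (cintegral_trig s fi).2 big1 // => p _; rewrite [cintegral _ _]f0 mulr0.
have [fr fim] := fi.
have r0 : {ae mu, forall a, complex.Re (f a) = 0}.
  apply: real_trig_annihilator => // q hq _; have := fq q hq.
  move=> /(congr1 (@complex.Re R)) /= <-; apply: eq_Rintegral => a _.
  by case: (f a) => u v /=; rewrite mulr0 subr0.
have i0 : {ae mu, forall a, complex.Im (f a) = 0}.
  apply: real_trig_annihilator => // q hq _; have := fq q hq.
  move=> /(congr1 (@complex.Im R)) /= <-; apply: eq_Rintegral => a _.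
  by case: (f a) => u v /=; rewrite mulr0 add0r.
by apply: filterS2 r0 i0 => a; case: (f a) => u v /= -> ->.
Qed.

End Approximation.

(** * The characterization *)

Section Characterization.
Context {R : realType} {L : PreTopologicalZmodule.type} {X : zmodType}.
Local Notation B := (borel L).
Hypothesis subC : continuous (fun p : L * L => p.1 - p.2).
Variable mu : {sigma_finite_measure set B -> \bar R}.
Hypothesis haar : is_haar mu.
Local Notation rint f := (mu.-integrable setT (fun y : B => (f y)%:E)).
Variable lambda : L -> R.
Hypothesis lambda_gt0 : forall a, 0 < lambda a.
Hypothesis lambda_C0 : C0 lambda.
Hypothesis lambda_int : rint lambda.
Variable e : X -> L -> R[i].
Hypothesis eD : forall x y a, e (x + y) a = e x a * e y a.
Hypothesis eA : forall x a b, e x (a + b) = e x a * e x b.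
Hypothesis e1 : forall x a, modc (e x a) = 1.
Hypothesis e_cont : forall x, continuous (e x : L -> R[i]^o).
Hypothesis e_sep : forall a b, (forall x, e x a = e x b) -> a = b.

Local Notation eB := (e : X -> B -> R[i]).
Local Notation H := (transform_space mu (lambda : B -> R) eB).
Local Notation ip := (transform_ip mu (lambda : B -> R) eB).
Local Notation k := (transform_kernel mu (lambda : B -> R) eB).
Local Notation conv := (self_convolution mu lambda).

(* Kernel sections carry conjugate characters, hence opposite frequencies. *)
Definition opp_freq (s : seq (R[i] * X)) := [seq (p.1, - p.2) | p <- s].

Lemma opp_freqK s : opp_freq (opp_freq s) = s.
Proof.
by rewrite /opp_freq -map_comp map_id_in // => -[c x] _ /=; rewrite opprK.
Qed.

Lemma opp_freq_conj s a : ((trig_poly e (opp_freq s) a)^*)%C =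
  trig_poly e [seq ((p.1^*)%C, p.2) | p <- s] a.
Proof.
rewrite /trig_poly !big_map rmorph_sum; apply: eq_bigr => p _ /=.
by rewrite conjcM (charN eD e1) conjcK.
Qed.

Lemma cintegrable_density (rho : B -> R) : rint rho ->
  cintegrable mu (fun a => (rho a)%:C%C).
Proof. by move=> hr; split => //=; exact: integrable0. Qed.

Lemma rint_density_trig (rho : B -> R) s : rint rho ->
  rint (fun a => rho a * modc (trig_poly e s a) ^+ 2).
Proof.
move=> /cintegrable_density hr.
(* |p|^2 is p times its conjugate, again a trigonometric polynomial, so the two factors are attached
   in turn. *)
have [h1 _] := cintegral_trig e1 e_cont s hr.
have [h2 _] := cintegral_trig e1 e_cont [seq ((p.1^*)%C, p.2) | p <- opp_freq s] h1.
have [+ _] := h2; apply: eq_rint => a.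
by rewrite -opp_freq_conj opp_freqK -mulrA mulcJE -rmorphM.
Qed.

(** The inner product is expanded one argument at a time, and each sum of integrals is folded back
    into the integral of a trigonometric polynomial. The second argument contributes conjugate
    coefficients, the first opposite frequencies. *)
Lemma gram_hnorm {V : lmodType R[i]} {K : set V} {ipK : V -> V -> R[i]}
    (u : X -> V) (rho : B -> R) : is_hilbert K ipK -> (forall x, K (u x)) ->
  rint rho -> (forall x y, ipK (u x) (u y) =
    cintegral mu (fun a : B => (rho a)%:C%C * ((e x a)^*)%C * e y a)) ->
  forall s, hnorm ipK (lincomb u s) ^+ 2 =
    \int[mu]_a (rho a * modc (trig_poly e (opp_freq s) a) ^+ 2).
Proof.
move=> hK Ku hr gram s; have Ks := hilbert_lincomb hK Ku s.
have KZ p : K (p.1 *: u p.2) by exact: (hilbertZ hK).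
pose s' := [seq ((p.1^*)%C, p.2) | p <- s].
have hrC := cintegrable_density hr.
have [hc _] := cintegral_trig e1 e_cont s' hrC.
have inner x : ipK (u x) (lincomb u s) =
    cintegral mu (fun a => (rho a)%:C%C * trig_poly e s' a * e (- x) a).
  rewrite /lincomb (ip_sumr hK) //.
  have hx : cintegrable mu (fun a : B => (rho a)%:C%C * ((e x a)^*)%C).
    apply: (cintegrable_bounded (M := 1)) => //.
      exact/cmeasurableJ/borel_ccontinuous.
    by move=> a; rewrite modcJ e1.
  transitivity (cintegral mu
      (fun a : B => (rho a)%:C%C * ((e x a)^*)%C * trig_poly e s' a)).
    rewrite (cintegral_trig e1 e_cont s' hx).2 big_map; apply: eq_bigr => p _ /=.
    by rewrite (ipZr hK) // gram.
  congr cintegral; apply/funext => a.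
  by rewrite (charN eD e1) mulrAC.
have -> : hnorm ipK (lincomb u s) ^+ 2 =
    complex.Re (ipK (lincomb u s) (lincomb u s)) by rewrite (hnorm_sqr hK).
rewrite {1}/lincomb (ip_suml hK) //.
have -> : \sum_(p <- s) ipK (p.1 *: u p.2) (lincomb u s) =
    cintegral mu (fun a : B => (rho a)%:C%C * trig_poly e s' a *
      trig_poly e (opp_freq s) a).
  rewrite (cintegral_trig e1 e_cont (opp_freq s) hc).2 big_map.
  by apply: eq_bigr => p _ /=; rewrite (ipZl hK) // inner.
under eq_fun do rewrite -opp_freq_conj -mulrA [_^*%C * _]mulrC mulcJE -rmorphM.
by rewrite cintegral_real.
Qed.

Lemma weight_transform_inj (f : B -> R[i]) : cintegrable mu f ->
  (forall x, transform mu eB f x = 0) -> {ae mu, forall a, f a = 0}.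
Proof.
apply: (char_transform_inj haar (@level_closed _ _ _ lambda_C0)
  (@level_compact _ _ _ lambda_gt0 lambda_C0) (@level_nondecreasing _ _ lambda)
  (bigcup_level lambda_gt0) eD e1 e_cont e_sep).
Qed.

Let me x : cmeasurable (eB x).
Proof. exact: borel_ccontinuous. Qed.

Lemma weight_hilbert : is_hilbert H ip.
Proof.
by apply: transform_hilbert => //; exact: weight_transform_inj.
Qed.

Lemma weight_kernel_section : is_kernel_section H ip k.
Proof.
by apply: transform_kernel_section => //; exact: weight_transform_inj.
Qed.

Lemma weight_rkhs : is_rkhs H ip.
Proof. exact: (kernel_section_rkhs weight_hilbert weight_kernel_section). Qed.

Lemma kernel_gram x y : ip (k x) (k y) =
  cintegral mu (fun a : B => (lambda a)%:C%C * ((e x a)^*)%C * e y a).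
Proof. by have [Hk kf] := weight_kernel_section; rewrite -kf. Qed.

Lemma kernel_hnorm s : hnorm ip (lincomb k s) ^+ 2 =
  \int[mu]_a (lambda a * modc (trig_poly e (opp_freq s) a) ^+ 2).
Proof.
have [Hk _] := weight_kernel_section.
exact: (gram_hnorm weight_hilbert Hk lambda_int kernel_gram).
Qed.

Section Tensor.
Context {W : lmodType R[i]} {T : set W} {ipT : W -> W -> R[i]}.
Context {tens : (X -> R[i]) -> (X -> R[i]) -> W}.
Hypothesis hT : is_hilbert_tensor H ip H ip T ipT tens.

Lemma diagonal_tensor_gram x y :
  ipT (tens (k x) (k x)) (tens (k y) (k y)) =
  cintegral mu (fun a : B => (conv a)%:C%C * ((e x a)^*)%C * e y a).
Proof.
have [Hk _] := weight_kernel_section.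
have eB_sub (f : B -> R) : cintegral mu (fun a : B => (f a)%:C%C * ((e x a)^*)%C * e y a) =
    cintegral mu (fun a : B => (f a)%:C%C * e (y - x) a).
  by congr cintegral; apply/funext => a; rewrite eD (charN eD e1) mulrAC mulrA.
rewrite (tensor_ip hT) // !kernel_gram !eB_sub -expr2.
by rewrite -(self_convolution_transform subC haar lambda_gt0 lambda_C0 lambda_int).
Qed.

Lemma diagonal_tensor_hnorm s :
  hnorm ipT (lincomb (fun x => tens (k x) (k x)) s) ^+ 2 =
  \int[mu]_a (conv a * modc (trig_poly e (opp_freq s) a) ^+ 2).
Proof.
have [Hk _] := weight_kernel_section.
apply: (gram_hnorm (tensor_hilbert hT)) => [x||].
- exact: (tensor_range hT).
- exact: (self_convolution_integrable subC haar lambda_gt0 lambda_C0 lambda_int).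
- exact: diagonal_tensor_gram.
Qed.

Lemma bounded_diagonal_dominates (M : R) :
  (forall s, hnorm ipT (lincomb (fun x => tens (k x) (k x)) s) <=
     M * hnorm ip (lincomb k s)) ->
  forall a, conv a <= M ^+ 2 * lambda a.
Proof.
move=> hM.
have conv_int : rint conv.
  exact: (self_convolution_integrable subC haar lambda_gt0 lambda_C0 lambda_int).
have conv_cont : continuous conv.
  exact: (self_convolution_continuous subC lambda_gt0 lambda_C0 lambda_int).
pose g a := M ^+ 2 * lambda a - conv a.
have g_int : rint g by apply: rintB => //; exact: rintZ.
have gq q : real_trig e q -> 0 <= \int[mu]_a (g a * q a ^+ 2).
  move=> [s sq].
  have qE a : q a ^+ 2 = modc (trig_poly e (opp_freq (opp_freq s)) a) ^+ 2.
    by rewrite opp_freqK -sq modc_real real_normK ?num_real.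
  (* The norm formulas reverse frequencies, so the combination with reversed ones is the one that
     produces [q]. Squaring is legitimate for any sign of [M] because [0 <= h1 <= M * h2]. *)
  have := hM (opp_freq s).
  set h1 := hnorm ipT _; set h2 := hnorm ip _ => h12.
  have h10 : 0 <= h1 := hnorm_ge0 _; have h20 : 0 <= h2 := hnorm_ge0 _.
  have : h1 ^+ 2 <= M ^+ 2 * h2 ^+ 2.
    by rewrite -exprMn ler_pXn2r // nnegrE; exact: le_trans h12.
  rewrite /h1 /h2 diagonal_tensor_hnorm kernel_hnorm -subr_ge0.
  rewrite -RintegralZl //; last exact: rint_density_trig.
  rewrite -RintegralB //; [|exact/rintZ/rint_density_trig|exact: rint_density_trig].
  rewrite (@eq_Rintegral _ _ _ mu setT (fun a => g a * q a ^+ 2)) // => a _.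
  by rewrite qE /g mulrBl mulrA.
(* [q ^+ 2] is as close to [\1_A] as [q], up to a factor 2 *)
have gA (A : set B) : measurable A -> 0 <= \int[mu]_a (g a * \1_A a).
  move=> mA; apply/ler_addgt0Pr => r r0; have r2 : 0 < r / 2 by rewrite divr_gt0.
  have [q [hq q01 hr]] := real_trig_approx_indic haar (@level_closed _ _ _ lambda_C0)
    (@level_compact _ _ _ lambda_gt0 lambda_C0) (@level_nondecreasing _ _ lambda)
    (bigcup_level lambda_gt0) eD e1 e_cont e_sep g_int mA r2.
  have mq := real_trig_measurable e_cont hq.
  have iq : rint (fun a => g a * q a ^+ 2).
    apply: rint_mul_bounded => //; first exact: measurable_funX.
    move=> a; have /andP[q0 q1] := q01 a.
    by rewrite ger0_norm ?exprn_ge0 // exprn_ile1.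
  have iA := rint_indic g_int mA.
  have iD : rint (fun a => `|g a| * `|q a - \1_A a|).
    apply: rint_mul_bounded; first exact: rint_norm.
      by apply: measurableT_comp => //; exact: measurable_funB.
    move=> a; rewrite normr_id indicE ler_norml; have := q01 a.
    by case: (_ \in _) => /=; lra.
  apply: le_trans (gq q hq) _.
  apply: (@le_trans _ _ (\int[mu]_a (g a * \1_A a + 2 * (`|g a| * `|q a - \1_A a|)))).
    apply: le_Rintegral => //; first by apply: rintD => //; exact: rintZ.
    move=> a _; rewrite -lerBlDl -mulrBr.
    apply: le_trans (ler_norm _) _; rewrite normrM mulrCA ler_wpM2l //.
    rewrite indicE; have := q01 a; case: (_ \in _) => /= /andP[q0 q1].
      by rewrite ler0_norm ?ler0_norm; nra.
    by rewrite !subr0 !ger0_norm ?exprn_ge0 //; nra.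
  rewrite RintegralD //; last exact: rintZ.
  rewrite RintegralZl //; lra.
have g_cont : continuous g.
  move=> a; apply: cvgB; last exact: conv_cont.
  by apply: cvgM; [exact: cvg_cst|exact: lambda_C0.1].
move=> a; rewrite -subr_ge0 leNgt; apply/negP => ga.
(* [U] is open, and by [gA] the integral of [g] over it is nonnegative although [g < 0] there; so
   [U] is null, against [haar_open_neq0]. *)
pose U := g @^-1` [set r | r < 0].
have oU : open U by move/continuousP : g_cont; apply; exact: open_lt.
apply: (@haar_open_neq0 _ _ subC mu haar _ U (@level_compact _ _ _ lambda_gt0 lambda_C0)
  (bigcup_level lambda_gt0) oU); first by exists a.
have mU : measurable (U : set B) by exact: borel_open.
have iU := rint_indic g_int mU.
have ngU y : 0 <= -1 * (g y * \1_U y).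
  rewrite mulN1r oppr_ge0 indicE; have [yU|_] := boolP (y \in U).
    by rewrite mulr1 ltW //; move: yU; rewrite inE.
  by rewrite mulr0.
have I0 : \int[mu]_y (-1 * (g y * \1_U y)) = 0.
  apply/eqP; rewrite eq_le Rintegral_ge0 // andbT RintegralZl // mulN1r oppr_le0.
  exact: gA.
have := Rintegral_eq0_ae (rintZ (-1) iU) ngU I0.
move=> [N [mN N0 hN]]; apply/negligibleP => //; exists N; split => // y Uy.
apply: hN => /= /eqP; rewrite mulN1r oppr_eq0 indicE mem_set // mulr1.
by apply/negP; rewrite lt_eqF.
Qed.

Lemma dominated_diagonal_bounded (C : R) : (forall a, conv a <= C * lambda a) ->
  forall s, hnorm ipT (lincomb (fun x => tens (k x) (k x)) s) <=
    Num.sqrt C * hnorm ip (lincomb k s).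
Proof.
(* The sign is read off at the point 0, where the convolution is nonnegative and [lambda] is
   positive. *)
move=> hC s; have C0' : 0 <= C.
  have := hC 0; have := self_convolution_ge0 mu lambda_gt0 0 => c0 /(le_trans c0).
  by rewrite pmulr_lge0.
rewrite -(ler_pXn2r (n := 2)) ?nnegrE ?mulr_ge0 ?sqrtr_ge0 ?hnorm_ge0 //.
set h1 := hnorm ipT _; set h2 := hnorm ip _.
rewrite exprMn (sqr_sqrtr C0') /h1 /h2 diagonal_tensor_hnorm kernel_hnorm.
have conv_int : rint conv.
  exact: (self_convolution_integrable subC haar lambda_gt0 lambda_C0 lambda_int).
rewrite -RintegralZl //; last exact: rint_density_trig.
apply: le_Rintegral => //.
- exact: rint_density_trig.
- exact/rintZ/rint_density_trig.
- by move=> a _; rewrite mulrA ler_wpM2r // exprn_ge0 // modc_ge0.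
Qed.

End Tensor.

Theorem rkha_iff_subconvolutive :
  is_rkha H ip <-> exists C, forall a, conv a <= C * lambda a.
Proof.
split.
  move=> [_ [k' [k'P [W [T [ipT [tens [hT [D [hD Dk]]]]]]]]]].
  (* [is_rkha] provides some kernel sections [k']; uniqueness identifies them with the explicit
     ones. *)
  have kk := kernel_section_unique weight_hilbert weight_kernel_section k'P.
  have [Hk _] := weight_kernel_section; rewrite kk in Dk.
  have [M hM] := blin_bounded hD.
  exists (M ^+ 2); apply: (bounded_diagonal_dominates hT) => s.
  suff <- : D (lincomb k s) = lincomb (fun x => tens (k x) (k x)) s.
    exact/hM/(hilbert_lincomb weight_hilbert Hk).
  elim: s => [|p s IH].
    (* For the empty combination, linearity at 1, 0, 0 gives [D 0 = D 0 + D 0]. *)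
    have H0 := hilbert_zero weight_hilbert.
    have := blin_linear hD 1 H0 H0; rewrite /lincomb !big_nil !scale1r addr0.
    by move=> /eqP; rewrite -subr_eq0 opprD addNKr oppr_eq0 => /eqP.
  rewrite /lincomb !big_cons -!/(lincomb _ _) (blin_linear hD) ?IH ?Dk //.
  exact: (hilbert_lincomb weight_hilbert Hk).
move=> [C hC]; split; first exact: weight_rkhs.
exists k; split; first exact: weight_kernel_section.
have hT : is_hilbert_tensor H ip H ip _ _ _ := transform_space_square_tensor
  (lambda_gt0 : forall y : B, 0 < lambda y) lambda_int me e1 weight_transform_inj.
do 4 eexists; split; first exact: hT.
have [Hk _] := weight_kernel_section.
apply: (bounded_linear_extension weight_hilbert (tensor_hilbert hT) Hk).
- by move=> x; exact: (tensor_range hT).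
- exact: (kernel_section_dense weight_hilbert weight_kernel_section).
- exact: (dominated_diagonal_bounded hT hC).
Qed.

End Characterization.

(** The product measure and Fubini's theorem take measures bundled with sigma-finiteness. An
    equality of plain measures lets the bundled one be substituted in the theorem. *)
Lemma sigma_finite_measureP {d : measure_display} {T : measurableType d}
    {R : realType} (mu : {measure set T -> \bar R}) : sigma_finite setT mu ->
  exists nu : {sigma_finite_measure set T -> \bar R},
    (nu : {measure set T -> \bar R}) = mu.
Proof.
case: mu => m [c1 c2] sf.
pose mu : {measure set T -> \bar R} := Measure.Pack (Measure.Class c2).
pose s1 := @isSFinite.Build _ _ _ mu (sfinite_measure_sigma_finite sf).
pose s2 := @isSigmaFinite.Build _ _ _ mu sf.
by exists (HB.pack (Measure.sort mu) s1 s2 : {sigma_finite_measure set T -> \bar R}).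
Qed.

Theorem theorem2p3 (R : realType) (G : topologicalZmodType)
  (hausG : hausdorff_space G) (lcG : locally_compact [set: G])
  (mu : {measure set (borel G) -> \bar R}) (haar_mu : is_haar mu)
  (muhat : {measure set (borel (dual R G)) -> \bar R})
  (haar_muhat : is_dual_haar mu muhat)
  (lambda : dual R G -> R)
  (lambda_gt0 : forall g, 0 < lambda g)
  (lambda_L1 : muhat.-integrable setT (fun g => (lambda g)%:E))
  (lambda_C0 : C0 lambda) :
  is_rkhs (Hspace muhat lambda) (Hip muhat lambda) /\
  is_kernel_section (Hspace muhat lambda) (Hip muhat lambda)
    (Hkernel muhat lambda) /\
  (is_rkha (Hspace muhat lambda) (Hip muhat lambda) <->
   subconvolutive muhat lambda).
Proof.
have haar := haar_muhat.1; move: {haar_muhat} haar => haar.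
have sf : sigma_finite setT muhat.
  exists (level lambda); first by rewrite bigcup_level.
  move=> n; split.
    by apply: (@borel_closed (dual R G) (level lambda n)); exact: level_closed.
  exact/(haar_compact haar)/(level_compact lambda_gt0 lambda_C0).
have [nu nuE] := sigma_finite_measureP sf; subst muhat.
pose ch (x : G) (a : dual R G) : R[i] := a x.
have chD (x y : G) a : ch (x + y) a = ch x a * ch y a by exact: dual_add.
have chA (x : G) a b : ch x (a + b) = ch x a * ch x b by [].
have ch1 x a : modc (ch x a) = 1 by exact: dual_modc.
have ch_cont (x : G) : continuous (ch x : dual R G -> R[i]^o).
  exact: dual_eval_continuous.
have ch_sep a b : (forall x, ch x a = ch x b) -> a = b by exact: dual_eq.
have subC := @dual_sub_continuous R G.
split; first exact: (weight_rkhs haar lambda_gt0 lambda_C0 lambda_L1 chD ch1 ch_cont ch_sep).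
split.
  exact: (weight_kernel_section haar lambda_gt0 lambda_C0 lambda_L1 chD ch1 ch_cont ch_sep).
have [h1 h2] := rkha_iff_subconvolutive subC haar lambda_gt0 lambda_C0 lambda_L1
  chD chA ch1 ch_cont ch_sep.
(* [subconvolutive] speaks of an extended integral and [self_convolution] of a real one; they agree
   because the integrand is integrable for every [g]. *)
have cE g : (\int[nu]_a (lambda a * lambda (g - (a : dual R G)))%:E =
    (self_convolution nu lambda g)%:E)%E.
  exact/rint_fin/(self_convolution_integrand subC lambda_gt0 lambda_C0 lambda_L1).
split => [/h1[C hC]|[C hC]].
  by exists C => g; rewrite cE lee_fin.
by apply: h2; exists C => g; rewrite -lee_fin -cE.
Qed.
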